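(* Let $\eta\approx 0.8105$ be the real root of $X^3+X^2+X-2$ and let $\alpha_0=\frac{\log 2}{\log 2-\log\eta}\approx 0.7674$. Then for any real numbers $\alpha,\beta$ with $\alpha_0\le\alpha\le\beta\le 1$ there exists a finitely generated group $G(\alpha,\beta)$ such that $$\liminf_{r\to\infty}\frac{\log\log b_{G(\alpha,\beta)}(r)}{\log r}=\alpha\quad\text{and}\quad \limsup_{r\to\infty}\frac{\log\log b_{G(\alpha,\beta)}(r)}{\log r}=\beta .$$ In particular, for every $\alpha\in[\alpha_0,1]$ there exists a finitely generated group $G(\alpha)$ such that $\lim_{r\to\infty}\frac{\log\log b_{G(\alpha)}(r)}{\log r}=\alpha$.
   Context: For a group $G$ with finite generating set $S$, the growth function $b_{G,S}(r)$ is the number of elements of $G$ that can be written as a product of at most $r$ elements of $S\cup S^{-1}$. The liminf and limsup of $\frac{\log\log b_{G,S}(r)}{\log r}$ as $r\to\infty$ do not depend on the choice of $S$, so one writes $b_G$ for $b_{G,S}$. *)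

(* Defs.v *)
From HB Require Import structures.
From mathcomp Require Import all_boot all_order all_algebra finmap.
From mathcomp Require Import all_classical all_reals all_analysis.

Set Implicit Arguments.
Unset Strict Implicit.
Unset Printing Implicit Defensive.

Import Order.TTheory GRing.Theory Num.Theory.
Import numFieldNormedType.Exports.

Local Open Scope classical_set_scope.

Definition word_ball (G : groupType) (S : {fset G}) (r : nat) : set G :=
  [set g | exists w : seq G,
     [/\ (size w <= r)%N,
         {in w, forall x, (x \in S) || (x^-1%g \in S)}
       & g = (\prod_(x <- w) x)%g]].

Definition generates (G : groupType) (S : {fset G}) : Prop :=
  forall g : G, exists r : nat, word_ball S r g.

Definition finitely_generated (G : groupType) : Prop :=
  exists S : {fset G}, generates S.

Definition growth (G : groupType) (S : {fset G}) (r : nat) : nat :=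
  #|` fset_set (word_ball S r)|%fset.

(* [fset_set] is the empty set on infinite arguments; balls are finite, so
   [growth] is the true cardinal. *)
Lemma finite_word_ball (G : groupType) (S : {fset G}) (r : nat) :
  finite_set (word_ball S r).
Proof.
elim: r => [|r IHr].
  apply: (@sub_finite_set _ _ [set 1%g]); last exact: finite_set1.
  by move=> g [[|x w] [//= _ _ ->]]; rewrite big_nil.
pose T : set G := [set` S] `|` (fun x => x^-1%g) @` [set` S].
have finT : finite_set T.
  by rewrite finite_setU; split; [|apply: finite_image]; exact: finite_fset.
apply: (@sub_finite_set _ _ ([set 1%g] `|`
  (fun p : G * G => (p.1 * p.2)%g) @` (T `*` word_ball S r))); last first.
  rewrite finite_setU; split; first exact: finite_set1.
  by apply: finite_image; exact: finite_setX.
move=> g [[|x w] [szw Sw ->]]; first by left; rewrite big_nil.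
right; exists (x, \prod_(y <- w) y)%g; last by rewrite big_cons.
split => /=.
- have /orP[xS|xS] := Sw x (mem_head x w); first by left.
  by right; exists (x^-1)%g => //; rewrite invgK.
- exists w; split=> // y yw; apply: Sw; by rewrite inE yw orbT.
Qed.

Definition growth_exponent (R : realType) (G : groupType) (S : {fset G})
    (r : nat) : R :=
  (ln (ln (growth S r)%:R) / ln r%:R)%R.

(* Main.v *)
Require Import Defs.
From HB Require Import structures.
From mathcomp Require Import all_boot all_order all_algebra finmap.
From mathcomp Require Import all_classical all_reals all_analysis.
From mathcomp Require Import ring lra zify.

Set Implicit Arguments.
Unset Strict Implicit.
Unset Printing Implicit Defensive.

Import Order.TTheory GRing.Theory Num.Theory.
Import numFieldNormedType.Exports.

Local Open Scope classical_set_scope.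

(* The groups are variants of the permutational wreath products Z/2 wr G_omega
   over Grigorchuk groups G_omega (Bartholdi-Erschler), acting on the vertices
   of the binary tree decorated with a lamp.  Passing from a level to the next
   one, omega is rotated (0 -> 1 -> 2 -> 0) when [t k] holds and kept otherwise.

   Upper bound: in a suitable metric the two restrictions of an element of
   length l to the next level have total length at most eta * l + O(1) at a
   rotating level, and l + O(1) at the other ones; each change of type costs a
   constant factor.  After K levels, T of them rotating, an element of length n
   is encoded by a word of length about eta ^ T * n + 2 ^ K.

   Lower bound: a substitution multiplies the lengths by 2 / eta, resp. 2, and
   turns a family of N words of the same shape, differing by their lamps only,
   into a family of N ^ 2 words; hence 2 ^ 2 ^ K elements of length about
   2 ^ K / eta ^ T.

   So ln (ln b(r)) / ln r is close to ln 2 / (ln 2 - th * ln eta), where th is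
   the density of rotating levels among the first K ~ ln r ones.  The densities
   are made to oscillate between any two given values of [0, 1], the type being
   constant on each block [m ^ 2, (m + 1) ^ 2), so that changes are negligible. *)

(** * Action on the decorated binary tree *)

Inductive letter := L0 | L1 | L2.

Definition next_letter (x : letter) :=
  match x with L0 => L1 | L1 => L2 | L2 => L0 end.

(* The group (Z/2)^3: a Klein four-group V times the lamp group.  [phi x] is a
   character of V whose kernel is generated by [spinal_of x false]. *)
Definition spinal : Type := bool * bool * bool.

Definition lamp (b : spinal) : bool := b.2.

Definition add_spinal (b b' : spinal) : spinal :=
  (b.1.1 (+) b'.1.1, b.1.2 (+) b'.1.2, b.2 (+) b'.2).

Definition one_spinal : spinal := (false, false, false).

Definition phi (x : letter) (b : spinal) : bool :=
  match x with L0 => b.1.1 | L1 => b.1.2 | L2 => b.1.1 (+) b.1.2 end.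

Definition spinal_of (x : letter) (e : bool) : spinal :=
  match x with
  | L0 => (false, true, e) | L1 => (true, false, e) | L2 => (true, true, e)
  end.

Lemma phiD x b b' : phi x (add_spinal b b') = phi x b (+) phi x b'.
Proof. by case: x b b' => [] [[[] []] []] [[[] []] []]. Qed.

(** Vertices are finite paths from the root, the root included; the second component is the state of
    the lamp. *)
Definition point : Type := seq bool * bool.

Definition flip (s : seq bool) : seq bool :=
  if s is i :: s' then ~~ i :: s' else [::].

Lemma flipK : involutive flip.
Proof. by case=> //= i s; rewrite negbK. Qed.

Definition act_a (y : point) : point := (flip y.1, y.2).

Lemma act_aK : involutive act_a.
Proof. by case=> s l; rewrite /act_a /= flipK. Qed.

Section Action.
Variable c : nat -> letter.

Fixpoint tree_b (k : nat) (b : spinal) (s : seq bool) : seq bool :=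
  match s with
  | [::] => [::]
  | false :: s' => false :: (if phi (c k) b then flip s' else s')
  | true :: s' => true :: tree_b k.+1 b s'
  end.

Definition act_b (k : nat) (b : spinal) (y : point) : point :=
  (tree_b k b y.1, y.2 (+) (lamp b && all id y.1)).

Lemma tree_b_add k b b' s : tree_b k b (tree_b k b' s) = tree_b k (add_spinal b b') s.
Proof.
elim: s k => [|[] s IHs] k //=; first by rewrite IHs.
by rewrite phiD; case: (phi _ b) (phi _ b') => [] [] //=; rewrite flipK.
Qed.

Lemma all_tree_b k b s : all id (tree_b k b s) = all id s.
Proof. by elim: s k => [|[] s IHs] k //=. Qed.

Lemma act_b_add k b b' y : act_b k b (act_b k b' y) = act_b k (add_spinal b b') y.
Proof.
case: y => s l; rewrite /act_b /= tree_b_add all_tree_b; congr pair.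
by case: b b' => [[b1 b2] e] [[b1' b2'] e'] /=; case: e e' l (all id s) => [] [] [] [].
Qed.

Lemma act_b1 k y : act_b k one_spinal y = y.
Proof.
case: y => s l; rewrite /act_b /= addbF; congr pair.
elim: s k => [|[] s IHs] k //=; first by rewrite IHs.
by case: (c k).
Qed.

Lemma act_bK k b : involutive (act_b k b).
Proof.
move=> y; rewrite act_b_add (_ : add_spinal b b = one_spinal) ?act_b1 //.
by case: b => [[[] []] []].
Qed.

(* The word [b_1 ... b_m] stands for the product a b_1 a b_2 ... a b_m. *)
Fixpoint act (k : nat) (s : seq spinal) (y : point) : point :=
  if s is b :: s' then act_a (act_b k b (act k s' y)) else y.

Lemma act_cat k s s' y : act k (s ++ s') y = act k s (act k s' y).
Proof. by elim: s => //= b s ->. Qed.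

Definition act2 (k : nat) (w : spinal * seq spinal) (y : point) : point :=
  act_b k w.1 (act k w.2 y).

Definition push (i : bool) (y : point) : point := (i :: y.1, y.2).

Arguments act_a : simpl never.
Arguments act_b : simpl never.
Arguments push : simpl never.

Lemma push_inj i i' y y' : push i y = push i' y' -> i = i' /\ y = y'.
Proof. by case: y y' => [s l] [s' l'] [-> -> ->]. Qed.

Lemma act_a_push i y : act_a (push i y) = push (~~ i) y.
Proof. by []. Qed.

Lemma act_b_push_true k b y : act_b k b (push true y) = push true (act_b k.+1 b y).
Proof. by []. Qed.

Lemma act_b_push_false k b y :
  act_b k b (push false y) = push false (if phi (c k) b then act_a y else y).
Proof. by rewrite /act_b /push /= andbF addbF; case: phi. Qed.

Definition mul_a (w : spinal * seq spinal) : spinal * seq spinal :=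
  (one_spinal, w.1 :: w.2).

Definition mul_b (b : spinal) (w : spinal * seq spinal) : spinal * seq spinal :=
  (add_spinal b w.1, w.2).

Lemma act2_mul_a k w y : act2 k (mul_a w) y = act_a (act2 k w y).
Proof. by rewrite /act2 /= act_b1. Qed.

Lemma act2_mul_b k b w y : act2 k (mul_b b w) y = act_b k b (act2 k w y).
Proof. by rewrite /act2 /= act_b_add. Qed.

(* [restrict k s i] is the pair (j, w) such that [s] maps the subtree below [i] to
   the subtree below [j], acting as [w] inside; a word of the form b_0 a b_1 ... a b_m
   is represented by the pair of b_0 and [b_1; ...; b_m]. *)
Definition restrict_b (k : nat) (b : spinal) (jw : bool * (spinal * seq spinal)) :=
  (jw.1, if jw.1 then mul_b b jw.2
         else if phi (c k) b then mul_a jw.2 else jw.2).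

Fixpoint restrict (k : nat) (s : seq spinal) (i : bool) :
    bool * (spinal * seq spinal) :=
  if s is b :: s' then
    let jw := restrict_b k b (restrict k s' i) in (~~ jw.1, jw.2)
  else (i, (one_spinal, [::])).

Definition restrict2 (k : nat) (w : spinal * seq spinal) (i : bool) :=
  restrict_b k w.1 (restrict k w.2 i).

Lemma act_b_restrict k b jw y :
  act_b k b (push jw.1 (act2 k.+1 jw.2 y)) =
  push jw.1 (act2 k.+1 (restrict_b k b jw).2 y).
Proof.
case: jw => -[] w /=; first by rewrite act_b_push_true act2_mul_b.
by rewrite act_b_push_false; case: ifP => //; rewrite act2_mul_a.
Qed.

Lemma act_restrict k s i y :
  act k s (push i y) = push (restrict k s i).1 (act2 k.+1 (restrict k s i).2 y).
Proof.
elim: s => [|b s IHs] /=; first by rewrite /act2 act_b1.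
by rewrite IHs act_b_restrict act_a_push.
Qed.

Lemma act2_restrict2 k w i y :
  act2 k w (push i y) = push (restrict2 k w i).1 (act2 k.+1 (restrict2 k w i).2 y).
Proof. by rewrite {1}/act2 act_restrict act_b_restrict. Qed.

(** A word permutes the two subtrees, so a single bit records this permutation in [code]. *)
Lemma restrict_negb k s : (restrict k s true).1 = ~~ (restrict k s false).1.
Proof. by elim: s => //= b s ->. Qed.

Lemma restrict2_negb k w : (restrict2 k w true).1 = ~~ (restrict2 k w false).1.
Proof. exact: restrict_negb. Qed.

(** * Encoding of an action by iterated restrictions *)

Definition lamp_parity (w : spinal * seq spinal) : bool :=
  lamp w.1 (+) foldr (fun b => addb (lamp b)) false w.2.

Lemma act2_nil k w l : act2 k w ([::], l) = ([::], l (+) lamp_parity w).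
Proof.
rewrite /act2 /act_b /lamp_parity; case: w => b s /=.
suff -> : act k s ([::], l) = ([::], l (+) foldr (fun b => addb (lamp b)) false s).
  by rewrite /= andbT -addbA [_ (+) lamp b]addbC.
elim: s => [|b' s IHs] /=; first by rewrite addbF.
by rewrite IHs /act_b /act_a /= andbT -addbA [_ (+) lamp b']addbC.
Qed.

Definition symbol : finType := option (bool * bool * bool).

(** The third bit of a node symbol is padding, so that nodes and letters share one alphabet of nine
    symbols. At the leaves [None] ends the word; as the depth [K] is known, concatenated codes can
    be parsed. *)
Fixpoint code (K k : nat) (w : spinal * seq spinal) : seq symbol :=
  if K is K'.+1 then
    Some ((restrict2 k w false).1, lamp_parity w, false) ::
      code K' k.+1 (restrict2 k w false).2 ++ code K' k.+1 (restrict2 k w true).2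
  else rcons (map Some (w.1 :: w.2)) None.

Lemma rcons_None_inj (s s' : seq spinal) (r r' : seq symbol) :
  rcons (map Some s) None ++ r = rcons (map Some s') None ++ r' -> s = s' /\ r = r'.
Proof.
elim: s s' => [|b s IHs] [|b' s'] //=; first by case.
by case=> -> /IHs[-> ->].
Qed.

(** The tails [r], [r'] carry the induction through the concatenation of two subcodes. The
    permutation bit and the restrictions determine the action below the root, the lamp parity
    determines it at the root. *)
Lemma code_inj K k w w' r r' :
  code K k w ++ r = code K k w' ++ r' -> act2 k w =1 act2 k w' /\ r = r'.
Proof.
elim: K k w w' r r' => [|K IHK] k w w' r r'.
  by case: w w' => [b s] [b' s'] /(@rcons_None_inj (b :: s) (b' :: s'))[[-> ->] ->].
move=> eqc; have eqj : (restrict2 k w false).1 = (restrict2 k w' false).1 by case: eqc.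
case: eqc => _ eql; rewrite -!catA => /IHK[eq0] /IHK[eq1 ->]; split=> //.
case=> -[|i s] l; first by rewrite !act2_nil eql.
rewrite -[(i :: s, l)]/(push i (s, l)) !act2_restrict2.
by case: i; rewrite ?eq1 ?eq0 ?(restrict2_negb k w) ?(restrict2_negb k w') eqj.
Qed.

(* A word in a b_y, a b_x is lifted one level up by a b_y -> a b_y a b_y for y <> x
   and a b_x -> a b_y a b_x a b_z.  Its two restrictions are then conjugates of the
   original word, up to a factor a, and their lamps [b], [b'] can be chosen
   independently. *)
Definition double_letter (x : letter) (b b' : spinal) : seq spinal :=
  if phi x b then [:: b; b']
  else [:: spinal_of (next_letter x) (lamp b'); b;
           spinal_of (next_letter (next_letter x)) false].

(* The boolean tells whether the lifted word exchanges the two subtrees. *)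
Fixpoint double_word (x : letter) (s0 s1 : seq spinal) : bool * seq spinal :=
  match s0, s1 with
  | b0 :: s0', b1 :: s1' =>
    let r := double_word x s0' s1' in
    (r.1 (+) ~~ phi x b0,
     (if r.1 then double_letter x b1 b0 else double_letter x b0 b1) ++ r.2)
  | _, _ => (false, [::])
  end.

Definition base (b : spinal) : bool * bool := b.1.

(** Change of coordinates in a subtree: below [true] the action is read directly, below [false]
    after a twist by a. *)
Definition a_unless (j : bool) (y : point) : point := if j then y else act_a y.

Lemma a_unlessK j : involutive (a_unless j).
Proof. by case: j => //=; exact: act_aK. Qed.

Lemma phi_base x b b' : base b = base b' -> phi x b = phi x b'.
Proof. by rewrite /base; case: x b b' => [] [b e] [b' e'] /= ->. Qed.

Lemma spinal_of_phi x b : base b != (false, false) -> ~~ phi x b ->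
  b = spinal_of x (lamp b).
Proof. by case: x b => [] [[[] []] e]. Qed.

Lemma add_spinal_of x e :
  add_spinal (spinal_of (next_letter x) e)
    (spinal_of (next_letter (next_letter x)) false) =
  spinal_of x e.
Proof. by case: x e => [] []. Qed.

Lemma phi_spinal_of x e :
  [/\ phi x (spinal_of x e) = false, phi x (spinal_of (next_letter x) e)
    & phi x (spinal_of (next_letter (next_letter x)) e)].
Proof. by case: x e => [] []. Qed.

(** If [phi] holds at [b], each subtree meets one of the two letters in full and gets an a from the
    other. Otherwise one subtree meets [b] in full between two a's, and the other meets the two
    outer letters, whose product is [b']. *)
Lemma act_double_letter k b b' j y :
  base b = base b' -> base b != (false, false) ->
  act k (double_letter (c k) b b') (push j y) =
  let j' := j (+) ~~ phi (c k) b in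
  push j' (a_unless j' (act k.+1 [:: if j then b' else b] (a_unless j y))).
Proof.
move=> eqb b0; rewrite /double_letter; case: (boolP (phi _ b)) => [phib|nphib].
  have phib' : phi (c k) b' by rewrite -(phi_base _ eqb).
  case: j => /=; rewrite ?(act_b_push_true, act_b_push_false, act_a_push) /=
    ?(act_b_push_true, act_b_push_false, act_a_push) ?phib ?phib' ?act_aK //.
have b'0 : base b' != (false, false) by rewrite -eqb.
have nphib' : ~~ phi (c k) b' by rewrite -(phi_base _ eqb).
have b'E := spinal_of_phi b'0 nphib'.
have [_ _ phiz] := phi_spinal_of (c k) false.
have [_ phiy' _] := phi_spinal_of (c k) (lamp b').
case: j; rewrite /= ?(negPf nphib);
  do 6?[rewrite !(act_b_push_true, act_b_push_false, act_a_push) /=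
          ?(negPf nphib) ?phiz ?phiy' /=];
  by rewrite ?act_b_add ?add_spinal_of ?act_aK -?b'E.
Qed.

Lemma act_double_word k s0 s1 i y :
  map base s0 = map base s1 -> (false, false) \notin map base s0 ->
  act k (double_word (c k) s0 s1).2 (push i y) =
  let j := i (+) (double_word (c k) s0 s1).1 in
  push j (a_unless j (act k.+1 (if i then s1 else s0) (a_unless i y))).
Proof.
elim: s0 s1 => [|b0 s0 IHs] [|b1 s1] //=.
  by case: i => //= _ _; rewrite /= act_aK.
case=> eqb eqs; rewrite inE eq_sym negb_or => /andP[b0n0 s0n0].
rewrite act_cat IHs //; set p := (double_word _ _ _).1.
have -> : (if p then double_letter (c k) b1 b0 else double_letter (c k) b0 b1) =
          double_letter (c k) (if p then b1 else b0) (if p then b0 else b1) by case: p.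
rewrite act_double_letter; try by case: p => //; rewrite -eqb.
have -> : phi (c k) (if p then b1 else b0) = phi (c k) b0.
  by case: p => //; apply: phi_base.
rewrite /= addbA; congr (push _ (a_unless _ _)).
rewrite [X in act_b _ X](_ : _ = if i then b1 else b0); last by case: (i) (p) => [] [].
by rewrite a_unlessK; case: (i).
Qed.

(** Up to twists, the lift acts as [s0] below [false] and as [s1] below [true], so it remembers both
    actions. *)
Lemma double_word_inj k s0 s1 s0' s1' :
  map base s0 = map base s1 -> map base s0' = map base s1' ->
  (false, false) \notin map base s0 -> (false, false) \notin map base s0' ->
  act k (double_word (c k) s0 s1).2 =1 act k (double_word (c k) s0' s1').2 ->
  act k.+1 s0 =1 act k.+1 s0' /\ act k.+1 s1 =1 act k.+1 s1'.
Proof.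
move=> eqs eqs' n0 n0' eqact.
have H i y : act k.+1 (if i then s1 else s0) y = act k.+1 (if i then s1' else s0') y.
  have := eqact (push i (a_unless i y)).
  by rewrite !act_double_word //= !a_unlessK => /push_inj[<-] /(can_inj (@a_unlessK _)).
by split=> y; [have := H false y | have := H true y].
Qed.

End Action.

Local Open Scope ring_scope.

(** * Metrics and substitutions *)

Section Metric.
Variables (R : realFieldType) (eta : R).
Hypothesis eta0 : 0 < eta.
Hypothesis eta1 : eta < 1.
Hypothesis etaE : eta ^+ 3 + eta ^+ 2 + eta = 2.

Lemma eta_facts :
  [/\ 0 < eta ^+ 3, eta ^+ 3 < eta ^+ 2 & eta ^+ 2 < eta] /\
  [/\ 0 < eta, eta < 1 & eta ^+ 3 + eta ^+ 2 + eta = 2].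
Proof.
split=> //; split; first exact: exprn_gt0.
  by rewrite exprSr gtr_pMr // exprn_gt0.
by rewrite expr2 gtr_pMr.
Qed.

Definition rate (t : bool) : R := if t then eta else 1.
Definition turn (t : bool) (x : letter) := if t then next_letter x else x.

(* The vector (eta ^ 2, eta, 1), indexed by the letters counted from [x], is an
   eigenvector both of the contraction (cost of a pair a b) and of the substitution. *)
Definition eigen (x : letter) (b : spinal) : R :=
  if ~~ phi x b then eta ^+ 2 else if ~~ phi (next_letter x) b then eta else 1.

Definition cost_a (t : bool) : R := if t then 1 - eta ^+ 3 else 1.

(* For a rotating level this is Bartholdi's metric, for which the largest of the
   three costs of V is the sum of the other two. *)
Definition cost_b (t : bool) (x : letter) (b : spinal) : R :=
  if base b == (false, false) then 0 else if t then eigen x b - cost_a t else 1.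

(** The left side is what the pair a b leaves to the next level: b in one subtree, and an a in the
    other one if [phi x b] holds. At a rotating level the shift of [eigen] makes this an equality
    when [base b] is nontrivial. *)
Lemma cost_b_contract t x b :
  cost_b t (turn t x) b + (if phi x b then cost_a t else 0) <=
  rate t * (cost_a t + cost_b t x b).
Proof.
have [[p1 p2 p3] [q1 q2 q3]] := eta_facts.
have e0 : 0 <= eta * (1 - eta ^+ 3) by apply: mulr_ge0; lra.
rewrite /cost_b /cost_a /rate /eigen /turn.
by case: t x b => [] [] [[[] []] e] /=; lra.
Qed.

(** At a rotating level the three costs are [1 - eta], [1 - eta ^+ 2] and [eta ^+ 3]; by [etaE] the
    last is the sum of the other two. *)
Lemma cost_b_add t x b b' :
  cost_b t x (add_spinal b b') <= cost_b t x b + cost_b t x b'.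
Proof.
have [[p1 p2 p3] [q1 q2 q3]] := eta_facts.
rewrite /cost_b /cost_a /eigen.
by case: t x b b' => [] [] [[[] []] e] [[[] []] e'] /=; lra.
Qed.

Lemma cost_b_ge0 t x b : 0 <= cost_b t x b.
Proof.
have [[p1 p2 p3] [q1 q2 q3]] := eta_facts.
rewrite /cost_b /cost_a /eigen.
by case: t x b => [] [] [[[] []] e] /=; lra.
Qed.

Lemma cost_a_ge t : 1 - eta <= cost_a t.
Proof.
have [[p1 p2 p3] [q1 q2 q3]] := eta_facts.
rewrite /cost_a; case: t; lra.
Qed.

Lemma cost_a_le1 t : cost_a t <= 1.
Proof.
have [[p1 p2 p3] [q1 q2 q3]] := eta_facts.
rewrite /cost_a; case: t; lra.
Qed.

Lemma cost_b_le1 t x b : cost_b t x b <= 1.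
Proof.
have [[p1 p2 p3] [q1 q2 q3]] := eta_facts.
rewrite /cost_b /cost_a /eigen.
by case: t x b => [] [] [[[] []] e] /=; lra.
Qed.

(** Costs are at most 1, and the nonzero ones are at least [1 - eta]. *)
Lemma cost_b_switch t t' x b : (1 - eta) * cost_b t x b <= cost_b t' x b.
Proof.
have [[p1 p2 p3] [q1 q2 q3]] := eta_facts.
rewrite /cost_b /cost_a /eigen.
by case: t t' x b => [] [] [] [[[] []] e] /=; nra.
Qed.

Definition cost (t : bool) (x : letter) (w : spinal * seq spinal) : R :=
  cost_b t x w.1 + \sum_(b <- w.2) (cost_a t + cost_b t x b).

Lemma cost_switch t t' x w : (1 - eta) * cost t x w <= cost t' x w.
Proof.
have [[p1 p2 p3] [q1 q2 q3]] := eta_facts.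
rewrite /cost mulrDr lerD ?cost_b_switch // mulr_sumr ler_sum // => b _.
rewrite mulrDr lerD ?cost_b_switch //.
have := cost_a_le1 t; have := cost_a_ge t'; nra.
Qed.

Lemma cost_ge_size t x w : (1 - eta) * (size w.2)%:R <= cost t x w.
Proof.
case: w => b s /=; rewrite /cost -[leLHS]add0r lerD ?cost_b_ge0 //=.
elim: s => [|b' s IHs]; first by rewrite mulr0 big_nil.
rewrite big_cons /= -natr1 mulrDr mulr1 [leRHS]addrC lerD //.
by rewrite -[leLHS]addr0 lerD ?cost_a_ge ?cost_b_ge0.
Qed.

Lemma cost_le_size t x w : cost t x w <= 2 * (size w.2)%:R + 1.
Proof.
case: w => b s /=; rewrite /cost addrC lerD ?cost_b_le1 //=.
elim: s => [|b' s IHs]; first by rewrite mulr0 big_nil.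
rewrite big_cons /= -[(size s).+1%:R]natr1 mulrDr mulr1 [leRHS]addrC lerD //.
by rewrite -[2]/(1 + 1) lerD ?cost_a_le1 ?cost_b_le1.
Qed.

Lemma cost_mul_a t x w : cost t x (mul_a w) = cost_a t + cost t x w.
Proof. by rewrite /cost /= big_cons /cost_b /= add0r addrA. Qed.

Lemma cost_mul_b t x b w : cost t x (mul_b b w) <= cost_b t x b + cost t x w.
Proof. by rewrite /cost /= addrA lerD2r cost_b_add. Qed.

(** * Weights of letters under the substitution *)

Definition weight (t : bool) (x : letter) (u : bool * bool) : R :=
  if t then eigen x (u, false) else if ~~ phi x (u, false) then 2 else 1.

Definition double_base (x : letter) (u : bool * bool) : seq (bool * bool) :=
  map base (double_letter x (u, false) (u, false)).

Lemma base_double_letter x b b' : base b = base b' ->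
  map base (double_letter x b b') = double_base x (base b).
Proof. by case: x b b' => [] [[[] []] e] [[[] []] e'] //=. Qed.

Lemma base_double_word x s0 s1 : map base s0 = map base s1 ->
  map base (double_word x s0 s1).2 = flatten (map (double_base x) (map base s0)).
Proof.
elim: s0 s1 => [|b0 s0 IHs] [|b1 s1] //= [eqb eqs].
rewrite map_cat IHs //; congr (_ ++ _).
by case: ifP => _; rewrite base_double_letter // eqb.
Qed.

Lemma double_base_neq0 x xi : (false, false) \notin xi ->
  (false, false) \notin flatten (map (double_base x) xi).
Proof.
elim: xi => //= u xi IHx; rewrite inE negb_or mem_cat => /andP[u0 /IHx H].
rewrite negb_or H andbT.
by case: x u u0 {IHx H} => [] [[] []].
Qed.

(** At a rotating level the letter in the kernel of [phi x] becomes three letters of weights [eta],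
    [eta ^+ 2] and 1, of sum [2 / eta] by [etaE]; the other letters are doubled. At the other levels
    (2, 1, 1) is an eigenvector for the factor 2. *)
Lemma weight_double_base t x u : u != (false, false) ->
  \sum_(v <- double_base x u) weight t x v <= 2 / rate t * weight t (turn t x) u.
Proof.
have [[p1 p2 p3] [q1 q2 q3]] := eta_facts.
have e2 : eta ^-1 * eta = 1 by rewrite mulVf // gt_eqF.
have e3 : eta ^-1 * eta ^+ 2 = eta by rewrite expr2 mulrA e2 mul1r.
have e4 : eta ^-1 * 2 = 1 + eta + eta ^+ 2.
  by rewrite -etaE !mulrDr e3 exprS mulrA e2; ring.
rewrite /weight /eigen /rate /turn /double_base.
by case: t x u => [] [] [[] []] //= _; rewrite !big_cons big_nil /= -?mulrA
  ?e2 ?e3 ?mulr1 ?[2 * _^-1]mulrC ?e4; lra.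
Qed.

Lemma weight_bounds t x u : eta ^+ 2 <= weight t x u <= 2.
Proof.
have [[p1 p2 p3] [q1 q2 q3]] := eta_facts.
by rewrite /weight /eigen; case: t x u => [] [] [[] []] /=; lra.
Qed.

(** * Restrictions and lifts along a sequence of levels *)

Section Sequence.
Variables (t : nat -> bool) (c : nat -> letter).
Hypothesis cS : forall k, c k.+1 = turn (t k) (c k).

(** The two restrictions arrive in different subtrees, so [b] multiplies one of them in full and the
    other one by a at most. *)
Lemma cost_restrict_b k b jw0 jw1 : jw1.1 = ~~ jw0.1 ->
  cost (t k) (c k.+1) (restrict_b c k b jw0).2 +
  cost (t k) (c k.+1) (restrict_b c k b jw1).2
  <= rate (t k) * (cost_a (t k) + cost_b (t k) (c k) b) +
     (cost (t k) (c k.+1) jw0.2 + cost (t k) (c k.+1) jw1.2).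
Proof.
have := cost_b_contract (t k) (c k) b; rewrite -cS.
case: jw0 jw1 => [[] w] [j w'] /= H ->; case: ifP H => _ H;
  rewrite /restrict_b /= ?cost_mul_a.
all: first [have := cost_mul_b (t k) (c k.+1) b w | idtac].
all: have := cost_mul_b (t k) (c k.+1) b w'; move: H; lra.
Qed.

Lemma cost_restrict k s :
  cost (t k) (c k.+1) (restrict c k s false).2 +
  cost (t k) (c k.+1) (restrict c k s true).2
  <= rate (t k) * \sum_(b <- s) (cost_a (t k) + cost_b (t k) (c k) b).
Proof.
elim: s => [|b s IHs].
  by rewrite big_nil mulr0 /cost /= !big_nil /cost_b /= !addr0.
rewrite big_cons mulrDr.
refine (le_trans (cost_restrict_b k b (restrict_negb c k s)) _).
by rewrite lerD2l.
Qed.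

(** The leading factor is not preceded by an a; the extra 1 bounds the missing [cost_a]. *)
Lemma cost_restrict2 k w :
  cost (t k) (c k.+1) (restrict2 c k w false).2 +
  cost (t k) (c k.+1) (restrict2 c k w true).2
  <= rate (t k) * (cost (t k) (c k) w + 1).
Proof.
have [[p1 p2 p3] [q1 q2 q3]] := eta_facts.
apply: le_trans (cost_restrict_b k w.1 (restrict_negb c k w.2)) _.
apply: le_trans (_ : _ <= rate (t k) * (cost_a (t k) + cost_b (t k) (c k) w.1)
   + rate (t k) * \sum_(b <- w.2) (cost_a (t k) + cost_b (t k) (c k) b)) _.
  by rewrite lerD2l cost_restrict.
rewrite -mulrDr ler_wpM2l //; first by rewrite /rate; case: ifP => _; lra.
by rewrite /cost; have := cost_a_le1 (t k); lra.
Qed.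

Fixpoint turns (K k : nat) : nat := if K is K'.+1 then t k + turns K' k.+1 else 0.
Fixpoint switches (K k : nat) : nat :=
  if K is K'.+1 then (t k != t k.+1) + switches K' k.+1 else 0.

Let C := (1 - eta)^-1.
Let C1 : 1 <= C.
Proof.
have [_ [q1 q2 q3]] := eta_facts.
by rewrite /C -invr1 lef_pV2 ?posrE; lra.
Qed.

(** The additive terms fit the induction: twice [2 * 2 ^+ K - 1], plus 1 for the overhead of
    [cost_restrict2], is [2 * 2 ^+ K.+1 - 1]; twice [4 * 2 ^+ K - 1], plus 1 for the node symbol, is
    [4 * 2 ^+ K.+1 - 1]. *)
Lemma size_code K k w :
  (size (code c K k w))%:R <=
  C * (C ^+ switches K k * (eta ^+ turns K k * cost (t k) (c k) w + 2 * 2 ^+ K - 1))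
  + 4 * 2 ^+ K - 1.
Proof.
have [[p1 p2 p3] [q1 q2 q3]] := eta_facts.
have C0 : 0 < C by have := C1; lra.
elim: K k w => [|K IHK] k w.
  rewrite /= size_rcons size_map !expr0 !mul1r !mulr1.
  have := cost_ge_size (t k) (c k) w.
  rewrite mulrC -ler_pdivlMr ?subr_gt0 // -/C mulrC.
  rewrite -addn2 natrD => H.
  rewrite -[cost _ _ _ + 2 - 1]addrA mulrDr; have := C1; lra.
rewrite [code _ _ _ _]/= /= -addn1 natrD size_cat natrD.
set w0 := (restrict2 c k w false).2; set w1 := (restrict2 c k w true).2.
have H0 := IHK k.+1 w0; have H1 := IHK k.+1 w1.
have Hc := cost_restrict2 k w; rewrite -/w0 -/w1 in Hc.
set S := switches K k.+1 in H0 H1 *; set T := turns K k.+1 in H0 H1 *.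
(* The restrictions were measured with the type of level [k]; measuring them with that of [k.+1]
   loses a factor [C] if the types differ. *)
have Hs : cost (t k.+1) (c k.+1) w0 + cost (t k.+1) (c k.+1) w1 <=
    C ^+ (t k != t k.+1) * (rate (t k) * (cost (t k) (c k) w + 1)).
  case: eqVneq => [<-|_]; first by rewrite mul1r.
  rewrite expr1; apply: le_trans (ler_wpM2l (ltW C0) Hc).
  by rewrite -ler_pdivrMl // invrK mulrDr lerD ?cost_switch.
have r01 : 0 < rate (t k) <= 1 by rewrite /rate; case: ifP => _; lra.
have rateE : rate (t k) = eta ^+ t k.
  by rewrite /rate; case: (t k); rewrite ?expr1 ?expr0.
have CS0 : 1 <= C ^+ S by rewrite exprn_ege1.
have CJ : 1 <= C ^+ (t k != t k.+1) by rewrite exprn_ege1.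
have eT : 0 < eta ^+ T <= 1 by rewrite exprn_gt0 // exprn_ile1 // ltW.
rewrite !exprD exprS -rateE.
set P : R := 2 ^+ K in H0 H1 *.
have P1 : 1 <= P by rewrite exprn_ege1 // ler1n.
set X := cost (t k) (c k) w in Hs *.
set J := C ^+ _ in Hs CJ *.
set CS := C ^+ S in H0 H1 CS0 *.
set E := eta ^+ T in H0 H1 eT *.
set r := rate (t k) in Hs r01 *.
set y0 := cost _ _ w0 in H0 Hs; set y1 := cost _ _ w1 in H1 Hs.
have Hm : CS * (E * y0 + 2 * P - 1) + CS * (E * y1 + 2 * P - 1) <=
          J * CS * (r * E * X + 2 * (2 * P) - 1).
  have -> : CS * (E * y0 + 2 * P - 1) + CS * (E * y1 + 2 * P - 1) =
     CS * (E * (y0 + y1) + 4 * P - 2) by ring.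
  have -> : J * CS * (r * E * X + 2 * (2 * P) - 1) =
     CS * (J * (r * E * X + 4 * P - 1)) by ring.
  apply: ler_wpM2l; first by lra.
  have h1 : E * (y0 + y1) <= E * (J * (r * (X + 1))) by apply: ler_wpM2l => //; lra.
  have h2 : r * E <= 1 by apply: mulr_ile1; lra.
  have h3 : 4 * P - 2 <= J * (4 * P - 2) by rewrite ler_peMl //; lra.
  have h4 : J * (r * E) <= J * 1 by rewrite ler_wpM2l //; lra.
  have -> : J * (r * E * X + 4 * P - 1) =
     J * (r * E * X) + J * (4 * P - 2) + J * 1 by ring.
  have h5 : E * (J * (r * (X + 1))) = J * (r * E * X) + J * (r * E) by ring.
  by lra.
have {}Hm := ler_wpM2l (ltW C0) Hm.
rewrite mulrDr in Hm; move: Hm H0 H1; lra.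
Qed.

(** * Families of words of one shape *)

(** Weights lie between [eta ^+ 2] and 2, so [D] bounds the loss at a change of type. *)
Let D : R := 2 / eta ^+ 2.

Let eta2_gt0 : 0 < eta ^+ 2. Proof. exact: exprn_gt0. Qed.

(** The common shape [xi] lets any two words of the family be lifted together, and gives them all
    the same weight. *)
Definition word_family (k N : nat) (L : R) : Prop :=
  exists (xi : seq (bool * bool)) (l : seq (seq spinal)),
    [/\ size l = N /\ uniq l, {in l, forall s, map base s = xi},
        (false, false) \notin xi,
        {in l &, forall s s', act c k s =1 act c k s' -> s = s'}
      & \sum_(u <- xi) weight (t k) (c k) u <= L].

Lemma word_family_switch k N L : word_family k.+1 N L ->
  exists (xi : seq (bool * bool)) (l : seq (seq spinal)),
    [/\ size l = N /\ uniq l, {in l, forall s, map base s = xi},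
        (false, false) \notin xi,
        {in l &, forall s s', act c k.+1 s =1 act c k.+1 s' -> s = s'}
      & \sum_(u <- xi) weight (t k) (c k.+1) u <= D ^+ (t k != t k.+1) * L].
Proof.
case=> xi [l [H1 H2 H3 H4 H5]]; exists xi, l; split=> //.
case: eqVneq => [->|_]; first by rewrite mul1r.
have D0 : 0 < D by rewrite divr_gt0.
apply: le_trans (_ : D * \sum_(u <- xi) weight (t k.+1) (c k.+1) u <= _).
  rewrite mulr_sumr; apply: ler_sum => u _.
  have /andP[h1 _] := weight_bounds (t k.+1) (c k.+1) u.
  have /andP[_ h2] := weight_bounds (t k) (c k.+1) u.
  apply: le_trans h2 _; rewrite -ler_pdivrMl // /D invf_div -mulrA.
  by rewrite mulVf ?mulr1 ?pnatr_eq0.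
by rewrite expr1 ler_wpM2l // ltW.
Qed.

(** All ordered pairs of words are lifted; [double_word_inj] keeps the [N ^ 2] lifts apart. *)
Lemma word_family_double k N L : word_family k.+1 N L ->
  word_family k (N ^ 2) (D ^+ (t k != t k.+1) * (2 / rate (t k)) * L).
Proof.
have [[p1 p2 p3] [q1 q2 q3]] := eta_facts.
case/word_family_switch=> xi [l [[szl ul] lxi xi0 linj Lxi]].
have r01 : 0 < rate (t k) <= 1 by rewrite /rate; case: ifP => _; lra.
have bl s0 s1 : s0 \in l -> s1 \in l -> map base s0 = map base s1.
  by move=> /lxi-> /lxi->.
have li s0 s1 s0' s1' : s0 \in l -> s1 \in l -> s0' \in l -> s1' \in l ->
    act c k (double_word (c k) s0 s1).2 =1 act c k (double_word (c k) s0' s1').2 ->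
    (s0, s1) = (s0', s1').
  move=> s0l s1l s0l' s1l' /double_word_inj[]; rewrite ?lxi // => e0 e1.
  by congr pair; apply: linj.
exists (flatten (map (double_base (c k)) xi)).
exists [seq (double_word (c k) s0 s1).2 | s0 <- l, s1 <- l]; split.
- split; first by rewrite size_allpairs szl.
  rewrite allpairs_uniq // => -[s0 s1] [s0' s1'] /allpairsP[[a b] [/= al bl' [-> ->]]].
  move=> /allpairsP[[a' b'] [/= al' bl'' [-> ->]]] e.
  by apply: li => // y; rewrite e.
- move=> s /allpairsP[[a b] [/= al bl' ->]].
  by rewrite base_double_word ?lxi // (lxi _ bl').
- exact: double_base_neq0.
- move=> s s' /allpairsP[[a b] [/= al bl' ->]] /allpairsP[[a' b'] [/= al' bl'' ->]].
  by move=> /(li _ _ _ _ al bl' al' bl'')[-> ->].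
- rewrite -mulrA mulrCA; apply: le_trans (ler_wpM2l _ Lxi); last first.
    by rewrite divr_ge0 //; lra.
  rewrite mulr_sumr big_flatten big_map big_seq [leRHS]big_seq.
  apply: ler_sum => u uxi; rewrite cS; apply: weight_double_base.
  by apply: contraNneq xi0 => <-.
Qed.

Lemma word_family_depth K k :
  word_family k (2 ^ (2 ^ K)) (D ^+ switches K k * (2 ^+ K / eta ^+ turns K k) * 2).
Proof.
elim: K k => [|K IHK] k.
  (* The seed consists of two one-letter words that differ by the lamp and are told apart at the
     root; their weight is at most 2. *)
  exists [:: base (spinal_of L0 false)].
  exists [:: [:: spinal_of L0 false]; [:: spinal_of L0 true]]; split=> //.
  - by move=> s; rewrite !inE => /orP[] /eqP->.
  - move=> s s'; rewrite !inE => /orP[] /eqP-> /orP[] /eqP-> //.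
      by move/(_ ([::], false)).
    by move/(_ ([::], false)).
  - rewrite big_cons big_nil addr0 /= !expr0 invr1 !mul1r.
    by have /andP[] := weight_bounds (t k) (c k) (base (spinal_of L0 false)).
have := word_family_double (IHK k.+1).
have -> : (2 ^ (2 ^ K.+1) = (2 ^ (2 ^ K)) ^ 2)%N by rewrite -expnM -expnSr.
rewrite /= !exprD [2 ^+ K.+1]exprS.
have -> : eta ^+ t k = rate (t k) by rewrite /rate; case: (t k); rewrite ?expr1 ?expr0.
rewrite invfM; congr word_family; ring.
Qed.

Lemma size_word_family k N L : word_family k N L ->
  exists l : seq (seq spinal),
    [/\ size l = N, uniq l, {in l, forall s, (size s)%:R <= L / eta ^+ 2}
      & {in l &, forall s s', act c k s =1 act c k s' -> s = s'}].
Proof.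
case=> xi [l [[szl ul] lxi xi0 linj Lxi]]; exists l; split=> // s sl.
rewrite ler_pdivlMr // -(size_map base) lxi //; apply: le_trans Lxi.
elim: (xi) => [|u xi' IHx]; first by rewrite big_nil mul0r.
rewrite big_cons /= -natr1 mulrDl mul1r addrC lerD //.
by have /andP[] := weight_bounds (t k) (c k) u.
Qed.

End Sequence.
End Metric.

(** * The groups *)

Section Balls.
Variable G : groupType.
Implicit Types (S : {fset G}) (g h : G).
Local Open Scope nat_scope.

Lemma word_ballS S m n g : m <= n -> word_ball S m g -> word_ball S n g.
Proof. by move=> mn [w [sw Sw ->]]; exists w; split=> //; apply: leq_trans mn. Qed.

Lemma word_ballM S m n g h :
  word_ball S m g -> word_ball S n h -> word_ball S (m + n) (g * h)%g.
Proof.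
move=> [w [sw Sw ->]] [w' [sw' Sw' ->]]; exists (w ++ w'); split.
- by rewrite size_cat leq_add.
- by move=> x; rewrite mem_cat => /orP[/Sw|/Sw'].
- by rewrite big_cat.
Qed.

Lemma word_ballV S n g : word_ball S n g -> word_ball S n (g^-1)%g.
Proof.
move=> [w [sw Sw ->]]; exists (map (fun x => x^-1%g) (rev w)); split.
- by rewrite size_map size_rev.
- by move=> x /mapP[y]; rewrite mem_rev => /Sw Sy ->; rewrite invgK orbC.
- by rewrite big_map prodgV revK.
Qed.

(** Rewriting each letter over [S'] multiplies lengths by at most the largest length needed for an
    element of [S]. *)
Lemma word_ball_le S S' : generates S' ->
  exists C, forall r, word_ball S r `<=` word_ball S' (C * r).
Proof.
move=> /choice[f fP]; exists (\max_(x <- S) f x)%N => r g [w [sw Sw ->]].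
pose M := \max_(x <- S) f x.
have le_wr : M * size w <= M * r by rewrite leq_mul2l sw orbT.
apply: (word_ballS le_wr).
elim: w Sw {sw le_wr} => [|x w IHw] Sw.
  by exists [::]; rewrite big_nil; split.
rewrite big_cons /= mulnS; apply: word_ballM; last first.
  by apply: IHw => y yw; apply: Sw; rewrite inE yw orbT.
have le y : y \in S -> f y <= M.
  by move=> yS; rewrite /M (big_rem _ yS) leq_maxl.
have /orP[xS|xS] := Sw x (mem_head _ _); first exact: word_ballS (le _ xS) (fP x).
by rewrite -[x]invgK; apply: word_ballV; exact: word_ballS (le _ xS) (fP _).
Qed.

Lemma mem_ball S r g : (g \in fset_set (word_ball S r)) <-> word_ball S r g.
Proof. by rewrite in_fset_set ?inE //; apply: finite_word_ball. Qed.

Lemma growth_leq (T : finType) S r (f : G -> T) :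
  {in word_ball S r &, injective f} -> growth S r <= #|T|.
Proof.
move=> finj; rewrite /growth; set A := fset_set _.
have u : uniq (map f (enum_fset A)).
  rewrite map_inj_in_uniq ?fset_uniq // => x y /mem_ball xA /mem_ball yA.
  by apply: finj; rewrite inE.
by rewrite -(size_map f) -(card_uniqP u) max_card.
Qed.

Lemma geq_growth S r (l : seq G) :
  uniq l -> {in l, forall g, word_ball S r g} -> size l <= growth S r.
Proof. by move=> ul lS; apply: uniq_leq_size => // g /lS /mem_ball. Qed.

End Balls.

(** * The group of transformations given by words *)

Section Group.
Variable c : nat -> letter.

(** An element is a transformation together with the mere existence of a word for it, so equal
    actions give equal elements. *)
Record wreath := Wreath
  { wreath_fun : point -> point; wreathP : exists s, wreath_fun = act c 0 s }.

Lemma wreath_inj : injective wreath_fun.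
Proof.
by case=> f fP [g gP] /= fg; subst g; rewrite (Prop_irrelevance fP gP).
Qed.

HB.instance Definition _ := gen_eqMixin wreath.
HB.instance Definition _ := gen_choiceMixin wreath.

Definition word_elt (s : seq spinal) : wreath := Wreath (ex_intro _ s erefl).

(** The inverse of a b is b a, which with an a before each letter reads a 1 a b a 1: three letters
    for one. *)
Definition inv_word (s : seq spinal) : seq spinal :=
  flatten [seq [:: one_spinal; b; one_spinal] | b <- rev s].

Lemma act_inv_letter b y :
  act c 0 [:: one_spinal; b; one_spinal] (act c 0 [:: b] y) = y.
Proof. by rewrite /= !act_b1 !act_aK act_bK. Qed.

Lemma act_letter_inv b y :
  act c 0 [:: b] (act c 0 [:: one_spinal; b; one_spinal] y) = y.
Proof. by rewrite /= !act_b1 act_aK act_bK act_aK. Qed.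

Lemma inv_word_cons b s :
  inv_word (b :: s) = inv_word s ++ [:: one_spinal; b; one_spinal].
Proof. by rewrite /inv_word rev_cons map_rcons -cats1 flatten_cat. Qed.

Lemma act_inv_word s y : act c 0 (inv_word s) (act c 0 s y) = y.
Proof.
elim: s y => // b s IHs y.
by rewrite inv_word_cons act_cat -[b :: s]cat1s act_cat act_inv_letter IHs.
Qed.

Lemma act_word_inv s y : act c 0 s (act c 0 (inv_word s) y) = y.
Proof.
elim: s y => // b s IHs y.
by rewrite inv_word_cons act_cat -[b :: s]cat1s act_cat IHs act_letter_inv.
Qed.

Definition wreath_word (g : wreath) : seq spinal := projT1 (cid (wreathP g)).

Lemma act_wreath_word g y : act c 0 (wreath_word g) y = wreath_fun g y.
Proof. by rewrite /wreath_word; case: cid => s /= ->. Qed.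

Definition mul_wreath (g h : wreath) : wreath :=
  word_elt (wreath_word g ++ wreath_word h).

Definition inv_wreath (g : wreath) : wreath :=
  word_elt (inv_word (wreath_word g)).

Lemma mul_wreathE g h y :
  wreath_fun (mul_wreath g h) y = wreath_fun g (wreath_fun h y).
Proof.
by rewrite /= act_cat !act_wreath_word.
Qed.

Lemma wreath_eqP (g h : wreath) : wreath_fun g =1 wreath_fun h -> g = h.
Proof. by move=> gh; apply/wreath_inj/funext. Qed.

Lemma mul_wreathA : associative mul_wreath.
Proof. by move=> f g h; apply: wreath_eqP => y; rewrite !mul_wreathE. Qed.

Lemma mul_1wreath : left_id (word_elt [::]) mul_wreath.
Proof. by move=> g; apply: wreath_eqP => y; rewrite mul_wreathE. Qed.

Lemma mul_wreath1 : right_id (word_elt [::]) mul_wreath.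
Proof. by move=> g; apply: wreath_eqP => y; rewrite mul_wreathE. Qed.

Lemma mul_Vwreath : left_inverse (word_elt [::]) inv_wreath mul_wreath.
Proof.
move=> g; apply: wreath_eqP => y; rewrite mul_wreathE /=.
by rewrite -(act_wreath_word g) act_inv_word.
Qed.

Lemma mul_wreathV : right_inverse (word_elt [::]) inv_wreath mul_wreath.
Proof.
move=> g; apply: wreath_eqP => y; rewrite mul_wreathE /=.
by rewrite -(act_wreath_word g) act_word_inv.
Qed.

HB.instance Definition _ := isGroup.Build wreath
  mul_wreathA mul_1wreath mul_wreath1 mul_Vwreath mul_wreathV.

Lemma word_elt_cat s s' : word_elt (s ++ s') = (word_elt s * word_elt s')%g.
Proof. by apply: wreath_eqP => y; rewrite mul_wreathE /= act_cat. Qed.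

Definition wreath_gens : {fset wreath} :=
  [fset x in [seq word_elt [:: b] | b <- enum {: bool * bool * bool}]]%fset.

Lemma word_elt_ball s : word_ball wreath_gens (size s) (word_elt s).
Proof.
exists [seq word_elt [:: b] | b <- s]; split; first by rewrite size_map.
  move=> x /mapP[b _ ->]; apply/orP; left; rewrite inE.
  by apply: map_f; rewrite mem_enum.
elim: s => [|b s IHs]; first by rewrite big_nil.
by rewrite big_cons -IHs -word_elt_cat.
Qed.

Lemma wreath_generates : generates wreath_gens.
Proof.
move=> g; case: (wreathP g) => s gs; exists (size s).
by rewrite (_ : g = word_elt s); [exact: word_elt_ball | apply: wreath_inj].
Qed.

Lemma wreath_fg : finitely_generated wreath.
Proof. by exists wreath_gens; exact: wreath_generates. Qed.

Lemma ball_word_elt r g : word_ball wreath_gens r g ->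
  exists s, (size s <= 3 * r)%N /\ g = word_elt s.
Proof.
move=> [w [sw Sw ->]].
suff [s [ss es]] : exists s, (size s <= 3 * size w)%N /\
    (\prod_(x <- w) x)%g = word_elt s.
  by exists s; split=> //; apply: leq_trans ss _; rewrite leq_mul2l.
elim: w Sw {sw} => [|x w IHw] Sw; first by exists [::]; rewrite big_nil.
have [|s [ss es]] := IHw.
  by move=> y yw; apply: Sw; rewrite inE yw orbT.
have [s' [ss' es']] : exists s', (size s' <= 3)%N /\ x = word_elt s'.
  have /orP[] := Sw x (mem_head _ _); rewrite inE => /mapP[b _ xE].
    by exists [:: b].
  exists [:: one_spinal; b; one_spinal]; split=> //.
  rewrite -[x]invgK xE; apply: mulg1_eq; rewrite -word_elt_cat.
  by apply: wreath_eqP => y; exact: act_letter_inv.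
exists (s' ++ s); rewrite size_cat big_cons /= mulnS leq_add //.
by rewrite es es' word_elt_cat.
Qed.

(** Each element of the ball is sent to the code of a chosen word, padded to length [L]. Codes are
    self-delimiting, so the padding keeps this map injective. *)
Lemma growth_wreath_leq (S : {fset wreath}) (K L n r : nat) :
  (forall g, word_ball S r g -> exists s, (size s <= n)%N /\ g = word_elt s) ->
  (forall s, (size s <= n)%N -> (size (code c K 0 (one_spinal, s)) <= L)%N) ->
  (growth S r <= 9 ^ L)%N.
Proof.
move=> ballS codeL.
(* The default values of [xget] here and of [insubd] below do not occur on the ball. *)
pose word g := xget [::] [set s | (size s <= n)%N /\ g = word_elt s].
pose pad (s : seq symbol) := s ++ nseq (L - size s) None.
pose f g : L.-tuple symbol :=
  insubd [tuple of nseq L None] (pad (code c K 0 (one_spinal, word g))).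
have -> : (9 ^ L = #|{: L.-tuple symbol}|)%N.
  by rewrite card_tuple card_option !card_prod card_bool.
apply: (@growth_leq _ _ _ _ f) => g h; rewrite !inE => /ballS gS /ballS hS fgh.
have [wg gE] := xgetPex [::] gS; have [wh hE] := xgetPex [::] hS.
have fE x : (size (word x) <= n)%N -> val (f x) = pad (code c K 0 (one_spinal, word x)).
  move=> wx; rewrite /f val_insubd size_cat size_nseq subnKC ?eqxx //.
  exact: codeL.
have /(code_inj (r := nseq _ _))[eqa _] :
    pad (code c K 0 (one_spinal, word g)) = pad (code c K 0 (one_spinal, word h)).
  by rewrite -!fE // fgh.
rewrite gE hE; apply: wreath_eqP => y /=.
by have := eqa y; rewrite /act2 /= !act_b1.
Qed.

Lemma growth_wreath_geq (S : {fset wreath}) (l : seq (seq spinal)) (r : nat) :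
  uniq l -> {in l &, forall s s', act c 0 s =1 act c 0 s' -> s = s'} ->
  {in l, forall s, word_ball S r (word_elt s)} ->
  (size l <= growth S r)%N.
Proof.
move=> ul linj lS; rewrite -(size_map word_elt); apply: geq_growth.
  rewrite map_inj_in_uniq // => s s' sl s'l e; apply: linj => // y.
  by have := congr1 (fun g => wreath_fun g y) e.
by move=> g /mapP[s /lS sS ->].
Qed.

End Group.

(** * From two-sided bounds to exponents *)

Section Ratio.
Variable R : realType.
Implicit Types a b c e p q x : R.

Lemma nat_gt x : exists M : nat, x < M%:R.
Proof.
by exists (Num.truncn `|x|).+1; apply: le_lt_trans (ler_norm x) (truncnS_gt _).
Qed.

Lemma ratio_le a b c e : 0 < a -> 0 < b -> 0 <= c -> 0 < e ->
  exists M : nat, forall m p q, (M <= m)%N ->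
    p <= m%:R ^+ 2 * a + c * m%:R -> m%:R ^+ 2 * b - c * m%:R <= q ->
    p / q <= a / b + e.
Proof.
(* The first term lets the gain from [e] absorb the linear errors, the second keeps the denominator
   positive. *)
move=> a0 b0 c0 e0; have [M hM] := nat_gt ((c + c * (a / b + e)) / (e * b) + c / b).
exists M => m p q Mm pm qm.
have m1 : (c + c * (a / b + e)) / (e * b) + c / b < m%:R.
  by apply: lt_le_trans hM _; rewrite ler_nat.
set u : R := m%:R in m1 pm qm.
have ab0 : 0 < a / b by rewrite divr_gt0.
have cab : 0 <= (c + c * (a / b + e)) / (e * b).
  rewrite divr_ge0 ?addr_ge0 ?mulr_ge0 ?(ltW e0) ?(ltW b0) //; lra.
have h1 : c + c * (a / b + e) <= u * (e * b).
  rewrite -ler_pdivrMr ?mulr_gt0 //; apply: le_trans (ltW m1).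
  by rewrite lerDl divr_ge0 // ltW.
have h2 : c < u * b.
  by rewrite -ltr_pdivrMr //; apply: le_lt_trans m1; rewrite lerDr.
have u0 : 0 < u by rewrite -(pmulr_lgt0 _ b0); exact: le_lt_trans h2.
have q0 : 0 < q.
  apply: lt_le_trans qm; have -> : u ^+ 2 * b - c * u = u * (u * b - c) by ring.
  by rewrite mulr_gt0 // subr_gt0.
rewrite ler_pdivrMr //; apply: (le_trans pm).
apply: le_trans (_ : (a / b + e) * (u ^+ 2 * b - c * u) <= _); last first.
  by rewrite ler_wpM2l //; lra.
have -> : (a / b + e) * (u ^+ 2 * b - c * u) =
   u ^+ 2 * (a / b * b) + u * (u * (e * b)) - u * (c * (a / b + e)) by ring.
rewrite divfK ?gt_eqF //.
have := ler_wpM2l (ltW u0) h1; rewrite mulrDr; lra.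
Qed.

Lemma ratio_ge a b c e : 0 < a -> 0 < b -> 0 <= c -> 0 < e ->
  exists M : nat, forall m p q, (M <= m)%N -> 0 < q ->
    m%:R ^+ 2 * a - c * m%:R <= p -> q <= m%:R ^+ 2 * b + c * m%:R ->
    a / b - e <= p / q.
Proof.
move=> a0 b0 c0 e0; have [M hM] := nat_gt ((c + c * (a / b)) / (e * b) + c / a).
exists M => m p q Mm q0 pm qm.
have m1 : (c + c * (a / b)) / (e * b) + c / a < m%:R.
  by apply: lt_le_trans hM _; rewrite ler_nat.
set u : R := m%:R in m1 pm qm.
have ab0 : 0 < a / b by rewrite divr_gt0.
have cab : 0 <= (c + c * (a / b)) / (e * b).
  apply: divr_ge0; last by apply: mulr_ge0; exact: ltW.
  by apply: addr_ge0 => //; apply: mulr_ge0 => //; exact: ltW.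
have h1 : c + c * (a / b) <= u * (e * b).
  rewrite -ler_pdivrMr ?mulr_gt0 //; apply: le_trans (ltW m1).
  by rewrite lerDl divr_ge0 // ltW.
have h2 : c < u * a.
  by rewrite -ltr_pdivrMr //; apply: le_lt_trans m1; rewrite lerDr.
have u0 : 0 < u by rewrite -(pmulr_lgt0 _ a0); exact: le_lt_trans h2.
rewrite ler_pdivlMr //; apply: le_trans pm.
(* A negative factor would reverse the upper bound on [q]; in that case [p] being nonnegative
   suffices. *)
have [abe|abe] := leP (a / b - e) 0.
  apply: le_trans (_ : 0 <= _); first by rewrite mulr_le0_ge0 // ltW.
  have -> : u ^+ 2 * a - c * u = u * (u * a - c) by ring.
  by apply: mulr_ge0; rewrite ?subr_ge0; exact: ltW.
apply: le_trans (ler_wpM2l (ltW abe) qm) _.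
have -> : (a / b - e) * (u ^+ 2 * b + c * u) =
   u ^+ 2 * (a / b * b) - u * (u * (e * b)) + u * (c * (a / b)) - c * u * e by ring.
rewrite divfK ?gt_eqF //.
have := ler_wpM2l (ltW u0) h1; rewrite mulrDr.
have : 0 <= c * u * e by rewrite !mulr_ge0 // ltW.
lra.
Qed.

(** The least index beyond [M] with [x < l m] works for a sequence that need not be monotone. *)
Lemma locate_scale (l : nat -> R) (M : nat) x :
  (exists m, (M <= m)%N && (x < l m)) -> l M <= x ->
  exists m, [/\ (M <= m)%N, l m <= x & x < l m.+1].
Proof.
move=> ex lM; case: (ex_minnP ex) => -[|m] /andP[Mm xm] minm.
  by move: Mm; rewrite leqn0 => /eqP M0; move: lM; rewrite M0 leNgt xm.
have Mm' : (M <= m)%N.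
  by move: Mm; rewrite leq_eqVlt => /orP[/eqP Mm|//]; move: lM; rewrite Mm leNgt xm.
exists m; split=> //; rewrite leNgt; apply/negP => xlm.
by have := minm m; rewrite Mm' xlm ltnn => /(_ isT).
Qed.

Lemma ln_le_ge1 x z : 1 <= z -> x <= z -> ln x <= ln z.
Proof.
move=> z1 xz; have [x0|x0] := leP x 0; first by rewrite ln0 // ln_ge0.
by rewrite ler_ln ?posrE //; lra.
Qed.

End Ratio.

(** * Exponents from the bounds at depth [m ^ 2] *)

Section Exponents.
Variables (R : realType) (eta th1 th2 D : R) (T f : nat -> nat).
Hypotheses (eta0 : 0 < eta) (eta1 : eta < 1).
Hypotheses (th10 : 0 <= th1) (th12 : th1 <= th2) (D1 : 1 <= D).
Hypothesis f_le : forall n m, (0 < n)%N ->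
  ln (f n)%:R <= D ^+ m.+1 * (eta ^+ T m * n%:R + 2 ^+ (m ^ 2)%N).
Hypothesis f_ge : forall n m,
  D ^+ m.+1 * (2 ^+ (m ^ 2)%N / eta ^+ T m) <= n%:R -> (2 ^ (2 ^ (m ^ 2)) <= f n)%N.
Hypothesis T_ge : forall m, th1 * m%:R ^+ 2 - 2 * m%:R <= (T m)%:R.
Hypothesis T_le : forall m, (T m)%:R <= th2 * m%:R ^+ 2 + 2 * m%:R.
Hypothesis T_inf : forall N, exists2 m, (N <= m)%N &
  (T m)%:R <= th1 * m%:R ^+ 2 + 2 * m%:R.
Hypothesis T_sup : forall N, exists2 m, (N <= m)%N &
  th2 * m%:R ^+ 2 - 2 * m%:R <= (T m)%:R.

Let a : R := ln 2.
Let h : R := - ln eta.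
Let d : R := ln D.
(** Logarithm of the length at which the two terms of [f_le] balance; [scale'] adds the loss at the
    changes of type and is the threshold of [f_ge]. *)
Let scale (m : nat) : R := m%:R ^+ 2 * a + (T m)%:R * h.
Let scale' (m : nat) : R := scale m + m.+1%:R * d.
Let expo (n : nat) : R := ln (ln (f n)%:R) / ln n%:R.
Let lim (th : R) : R := a / (a + th * h).

Let pos : [/\ 0 < a, 0 < h, 0 <= d & 0 <= th2].
Proof.
split; [by rewrite ln_gt0 ?ltr1n | | exact: ln_ge0 | exact: le_trans th12].
by rewrite oppr_gt0 ln_lt0 // eta0.
Qed.

Lemma scaleE m : scale m = ln (2 ^+ (m ^ 2)%N / eta ^+ T m).
Proof.
rewrite ln_div ?posrE ?exprn_gt0 // !lnXn //.
rewrite -[ln 2 *+ _]mulr_natl -[ln eta *+ _]mulr_natl natrX.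
by rewrite /scale /h mulrN.
Qed.

Lemma scale'E m : scale' m = ln (D ^+ m.+1 * (2 ^+ (m ^ 2)%N / eta ^+ T m)).
Proof.
rewrite lnM ?posrE ?divr_gt0 ?exprn_gt0 //; last exact: lt_le_trans D1.
by rewrite -scaleE lnXn ?(lt_le_trans _ D1) // -[ln D *+ _]mulr_natl addrC.
Qed.

(** The slack [ln 2] leaves room for rounding a real scale to an integer length, as in
    [nat_near]. *)
Lemma lnln_f_le : exists2 c, 0 <= c & forall m n, (0 < m)%N -> (0 < n)%N ->
  ln n%:R <= scale m + ln 2 -> ln (ln (f n)%:R) <= m%:R ^+ 2 * a + c * m%:R.
Proof.
have [a0 h0 d0 _] := pos.
exists (ln 3 + 2 * d); first by rewrite addr_ge0 ?ln_ge0 ?mulr_ge0 ?ler1n.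
move=> m n m0 n0 nm.
have P1 : 1 <= 2 ^+ (m ^ 2)%N :> R by rewrite exprn_ege1 // ler1n.
have e0 : 0 < eta ^+ T m by rewrite exprn_gt0.
have n2 : eta ^+ T m * n%:R <= 2 * 2 ^+ (m ^ 2)%N.
  rewrite -ler_pdivlMl // mulrCA.
  rewrite -ler_ln ?posrE ?ltr0n ?mulr_gt0 ?divr_gt0 ?exprn_gt0 ?invr_gt0 //.
  rewrite [X in ln (2 * X)]mulrC lnM ?posrE ?divr_gt0 ?exprn_gt0 //.
  by rewrite -scaleE addrC.
have DE : 1 <= D ^+ m.+1 by rewrite exprn_ege1.
have fm : ln (f n)%:R <= D ^+ m.+1 * (3 * 2 ^+ (m ^ 2)%N).
  by apply: le_trans (f_le m n0) _; rewrite ler_wpM2l //; lra.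
apply: le_trans (ln_le_ge1 _ fm) _; first by nra.
have D0 : 0 < D by exact: lt_le_trans D1.
rewrite !lnM ?posrE ?mulr_gt0 ?exprn_gt0 // !lnXn //.
rewrite -[ln D *+ _]mulr_natl -[ln 2 *+ _]mulr_natl natrX -/a -/d.
have m1 : 1 <= m%:R :> R by rewrite ler1n.
have l3 : 0 <= ln 3 :> R by rewrite ln_ge0 // ler1n.
rewrite -natr1; nra.
Qed.

Lemma lnln_f_ge : exists2 c, 0 <= c & forall m n, (0 < m)%N -> (0 < n)%N ->
  scale' m <= ln n%:R -> m%:R ^+ 2 * a - c * m%:R <= ln (ln (f n)%:R).
Proof.
have [a0 h0 d0 _] := pos.
(* The second logarithm turns the factor [a = ln 2] into an additive [ln a]. *)
exists `|ln a| => // m n m0 n0 nm.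
have D0 : 0 < D by exact: lt_le_trans D1.
have fn : (2 ^ (2 ^ (m ^ 2)) <= f n)%N.
  apply: f_ge; rewrite -ler_ln ?posrE ?ltr0n ?mulr_gt0 ?invr_gt0 ?exprn_gt0 //.
  by rewrite -scale'E.
have a' : 0 < 2 ^+ (m ^ 2)%N * a by rewrite mulr_gt0 ?exprn_gt0.
have lf : 2 ^+ (m ^ 2)%N * a <= ln (f n)%:R.
  rewrite -natrX mulr_natl -[ln 2 *+ _]lnXn // ler_ln ?posrE ?exprn_gt0 ?ltr0n //.
    by rewrite -natrX ler_nat.
  by apply: leq_trans fn; rewrite expn_gt0.
apply: le_trans (_ : ln (2 ^+ (m ^ 2)%N * a) <= _); last first.
  by rewrite ler_ln ?posrE //; exact: lt_le_trans lf.
rewrite lnM ?posrE ?exprn_gt0 // lnXn // -[ln 2 *+ _]mulr_natl natrX -/a lerD2l.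
have m1 : 1 <= m%:R :> R by rewrite ler1n.
have := ler_norm (- ln a); rewrite normrN => ha.
have := normr_ge0 (ln a); nra.
Qed.

Lemma scale_ge m : m%:R * a <= scale m.
Proof.
have [a0 h0 _ _] := pos; rewrite /scale -[leLHS]addr0 lerD //; last first.
  by rewrite mulr_ge0 // ltW.
by rewrite ler_wpM2r ?(ltW a0) // -natrX ler_nat; case: (m) => // k; rewrite leq_pmulr.
Qed.

Lemma scale'_ge m : scale m <= scale' m.
Proof. by have [_ _ d0 _] := pos; rewrite lerDl mulr_ge0. Qed.

Lemma scale_unbounded M x : exists m, (M <= m)%N && (x < scale m).
Proof.
have [a0 _ _ _] := pos; have [m hm] := nat_gt (x / a); exists (maxn M m).
rewrite leq_maxl /=; apply: lt_le_trans (scale_ge _); rewrite -ltr_pdivrMr //.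
by apply: lt_le_trans hm _; rewrite ler_nat leq_maxr.
Qed.

Lemma scale'_unbounded M x : exists m, (M <= m)%N && (x < scale' m).
Proof.
have [m /andP[Mm xm]] := scale_unbounded M x; exists m.
by rewrite Mm (lt_le_trans xm) ?scale'_ge.
Qed.

Lemma nat_near x : 0 <= x ->
  exists2 n : nat, (0 < n)%N & x <= ln (n%:R : R) <= x + ln 2.
Proof.
move=> x0; have e1 : 1 <= expR x by have := expR_ge1Dx x; lra.
exists (Num.truncn (expR x)).+1 => //.
have /andP[h1 h2] := truncn_itv (expR_ge0 x).
apply/andP; split.
  by rewrite -[leLHS]expRK ler_ln ?posrE ?expR_gt0 ?ltr0n // ltW.
rewrite -[x in leRHS]expRK -lnM ?posrE ?expR_gt0 //.
rewrite ler_ln ?posrE ?ltr0n ?mulr_gt0 ?expR_gt0 //.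
by rewrite -natr1; lra.
Qed.

Lemma ln_unbounded x :
  exists N, forall n, (N <= n)%N -> (0 < n)%N /\ x <= ln (n%:R : R).
Proof.
have [N hN] := nat_gt (expR x); exists N => n Nn.
have n0 : expR x < n%:R by apply: lt_le_trans hN _; rewrite ler_nat.
have n1 : (0 < n)%N by rewrite -(ltr0n R); apply: lt_trans n0; exact: expR_gt0.
by split=> //; rewrite -[leLHS]expRK ler_ln ?posrE ?expR_gt0 ?ltr0n // ltW.
Qed.

(** With [ln n] between two consecutive scales, the upper one bounds the numerator and the lower one
    the denominator. The lowest density of rotations gives the largest exponent. *)
Lemma expo_le e : 0 < e -> exists N, forall n, (N <= n)%N -> expo n <= lim th1 + e.
Proof.
move=> e0; have [a0 h0 d0 th20] := pos; have [c c0 hc] := lnln_f_le.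
have b0 : 0 < a + th1 * h by rewrite ltr_wpDr // mulr_ge0 // ltW.
(* [3 * a + 2 * c] pays for replacing [m.+1] by [m] in the numerator, [2 * h] for the error in
   [T_ge]. *)
have cc : 0 <= 3 * a + 2 * c + 2 * h by lra.
have [M hM] := ratio_le a0 b0 cc e0.
have [N hN] := ln_unbounded (scale M.+1); exists N => n /hN[n0 nN].
have [m [Mm mn nm]] := locate_scale (scale_unbounded M.+1 _) nN.
have m0 : (0 < m)%N by exact: leq_ltn_trans Mm.
have m1 : 1 <= m%:R :> R by rewrite ler1n.
apply: (hM m) => //; first exact: ltnW.
  apply: le_trans (hc m.+1 n _ n0 _) _ => //.
    by rewrite (le_trans (ltW nm)) // lerDl ltW.
  rewrite -natr1; nra.
apply: le_trans mn; rewrite /scale.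
have := ler_wpM2r (ltW h0) (T_ge m); nra.
Qed.

Lemma expo_ge e : 0 < e -> exists N, forall n, (N <= n)%N -> lim th2 - e <= expo n.
Proof.
move=> e0; have [a0 h0 d0 th20] := pos; have [c c0 hc] := lnln_f_ge.
have b0 : 0 < a + th2 * h by rewrite ltr_wpDr // mulr_ge0 // ltW.
have cc : 0 <= c + 3 * (a + th2 * h) + 4 * h + 3 * d by lra.
have [M hM] := ratio_ge a0 b0 cc e0.
have [N hN] := ln_unbounded (scale' M.+1); exists N => n /hN[n0 nN].
have [m [Mm mn nm]] := locate_scale (scale'_unbounded M.+1 _) nN.
have m0 : (0 < m)%N by exact: leq_ltn_trans Mm.
have m1 : 1 <= m%:R :> R by rewrite ler1n.
have mp : 0 < m%:R :> R by lra.
have cb : 0 <= (3 * (a + th2 * h) + 4 * h + 3 * d) * m%:R by rewrite mulr_ge0; lra.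
apply: (hM m) => //; first exact: ltnW.
- apply: lt_le_trans mn; apply: lt_le_trans (scale'_ge m).
  by apply: lt_le_trans (scale_ge m); rewrite mulr_gt0.
- by apply: le_trans (hc m n m0 n0 mn); lra.
apply: le_trans (ltW nm) _; rewrite /scale' /scale.
have := ler_wpM2r (ltW h0) (T_le m.+1); rewrite -!natr1.
have : 0 <= c * m%:R by rewrite mulr_ge0.
have : 0 <= (m%:R - 1) * (a + th2 * h) by rewrite mulr_ge0; lra.
have : 0 <= (m%:R - 1) * h by rewrite mulr_ge0; lra.
have : 0 <= (m%:R - 1) * d by rewrite mulr_ge0; lra.
lra.
Qed.

Lemma nat_le_scale m n : scale m <= ln n%:R -> (0 < n)%N -> (m <= n)%N.
Proof.
have [a0 h0 _ _] := pos; move=> mn n0; rewrite leqNgt; apply/negP => nm.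
have : ln n%:R < m%:R * a; last by rewrite ltNge (le_trans (scale_ge m)).
rewrite mulr_natl -[ln 2 *+ _]lnXn // ltr_ln ?posrE ?exprn_gt0 ?ltr0n //.
by rewrite -natrX ltr_nat (ltn_trans nm) // ltn_expl.
Qed.

(** At a depth given by [T_inf], [n] is taken just above the threshold from which the lower bound
    applies. *)
Lemma expo_freq_ge e N : 0 < e -> exists2 n, (N <= n)%N & lim th1 - e <= expo n.
Proof.
move=> e0; have [a0 h0 d0 th20] := pos; have [c c0 hc] := lnln_f_ge.
have b0 : 0 < a + th1 * h by rewrite ltr_wpDr // mulr_ge0 // ltW.
have cc : 0 <= c + 2 * h + 2 * d + a by lra.
have [M hM] := ratio_ge a0 b0 cc e0.
have [m Mm Tm] := T_inf (maxn M N).+1.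
have m0 : (0 < m)%N by exact: leq_ltn_trans Mm.
have m1 : 1 <= m%:R :> R by rewrite ler1n.
have mp : 0 < m%:R :> R by lra.
have s0 : m%:R * a <= scale' m := le_trans (scale_ge m) (scale'_ge m).
have ma : 0 < m%:R * a by rewrite mulr_gt0.
have [n n0 /andP[n1 n2]] := nat_near (le_trans (ltW ma) s0).
exists n.
  apply: leq_trans (nat_le_scale (le_trans (scale'_ge m) n1) n0).
  by apply: leq_trans (ltnW Mm); exact: leq_maxr.
apply: (hM m).
- by apply: leq_trans (ltnW Mm); exact: leq_maxl.
- exact: lt_le_trans (le_trans s0 n1).
- by apply: le_trans (hc m n m0 n0 n1); nra.
apply: le_trans n2 _; rewrite /scale' /scale -/a.
have := ler_wpM2r (ltW h0) Tm; rewrite -!natr1.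
have : 0 <= c * m%:R by rewrite mulr_ge0.
have : 0 <= (m%:R - 1) * a by rewrite mulr_ge0; lra.
have : 0 <= (m%:R - 1) * d by rewrite mulr_ge0; lra.
lra.
Qed.

Lemma expo_freq_le e N : 0 < e -> exists2 n, (N <= n)%N & expo n <= lim th2 + e.
Proof.
move=> e0; have [a0 h0 d0 th20] := pos; have [c c0 hc] := lnln_f_le.
have b0 : 0 < a + th2 * h by rewrite ltr_wpDr // mulr_ge0 // ltW.
have cc : 0 <= c + 2 * h by lra.
have [M hM] := ratio_le a0 b0 cc e0.
have [m Mm Tm] := T_sup (maxn M N).+1.
have m0 : (0 < m)%N by exact: leq_ltn_trans Mm.
have m1 : 1 <= m%:R :> R by rewrite ler1n.
have mp : 0 < m%:R :> R by lra.
have ma : 0 < m%:R * a by rewrite mulr_gt0.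
have [n n0 /andP[n1 n2]] := nat_near (le_trans (ltW ma) (scale_ge m)).
have ch : 0 <= h * m%:R by rewrite mulr_ge0 // ltW.
have ch' : 0 <= c * m%:R by rewrite mulr_ge0 // ltW.
exists n.
  apply: leq_trans (nat_le_scale n1 n0).
  by apply: leq_trans (ltnW Mm); exact: leq_maxr.
apply: (hM m).
- by apply: leq_trans (ltnW Mm); exact: leq_maxl.
- by apply: le_trans (hc m n m0 n0 n2) _; lra.
apply: le_trans n1; rewrite /scale.
have := ler_wpM2r (ltW h0) Tm; lra.
Qed.

End Exponents.

(** * Limits characterized by epsilons *)

Section Limits.
Variable R : realType.
Implicit Types (u : nat -> R) (b : R).

Lemma limn_esup_eq u b :
  (forall e, 0 < e -> exists N, forall n, (N <= n)%N -> u n <= b + e) ->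
  (forall e N, 0 < e -> exists2 n, (N <= n)%N & b - e <= u n) ->
  limn_esup (fun n => (u n)%:E) = b%:E.
Proof.
move=> ub lb; apply/eqP; rewrite eq_le; apply/andP; split.
  apply/lee_addgt0Pr => e e0; have [N hN] := ub e e0.
  apply: (@le_trans _ _ (ereal_sup ((fun n => (u n)%:E) @` [set n | (N <= n)%N]))).
    by apply: ereal_inf_lbound; exists [set n | (N <= n)%N] => //; exists N.
  by apply: ge_ereal_sup => _ [n /hN Nn <-]; rewrite -EFinD lee_fin.
apply/lee_subgt0Pr => e e0; apply: le_ereal_inf_tmp => _ [V [N _ NV] <-].
have [n Nn bn] := lb e N e0.
apply: (@le_trans _ _ (u n)%:E); first by rewrite -EFinB lee_fin.
by apply: ereal_sup_ubound; exists n => //; apply: NV.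
Qed.

Lemma limn_einf_eq u b :
  (forall e, 0 < e -> exists N, forall n, (N <= n)%N -> b - e <= u n) ->
  (forall e N, 0 < e -> exists2 n, (N <= n)%N & u n <= b + e) ->
  limn_einf (fun n => (u n)%:E) = b%:E.
Proof.
move=> lb ub; rewrite /limn_einf -[X in (- X)%E]/(limn_esup (fun n => (- u n)%:E)).
rewrite (@limn_esup_eq _ (- b)) ?EFinN ?oppeK // => e.
  move=> e0; have [N hN] := lb e e0; exists N => n /hN; lra.
by move=> N e0; have [n Nn h] := ub e N e0; exists n => //; lra.
Qed.

Lemma cvgn_eq u b :
  (forall e, 0 < e -> exists N, forall n, (N <= n)%N -> u n <= b + e) ->
  (forall e, 0 < e -> exists N, forall n, (N <= n)%N -> b - e <= u n) ->
  u n @[n --> \oo] --> b.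
Proof.
move=> ub lb; apply/cvgrPdist_le => e e0.
have [N hN] := ub e e0; have [M hM] := lb e e0.
exists (maxn N M) => // n /=; rewrite geq_max => /andP[/hN h1 /hM h2].
by rewrite ler_norml; apply/andP; split; lra.
Qed.

End Limits.

(** * Level types of prescribed densities *)

Section Blocks.
Variable tau : nat -> bool.

Fixpoint isqrt (k : nat) : nat :=
  if k is k'.+1 then
    if ((isqrt k').+1 ^ 2 <= k'.+1)%N then (isqrt k').+1 else isqrt k'
  else 0%N.

Lemma isqrt_bounds k : (isqrt k ^ 2 <= k < (isqrt k).+1 ^ 2)%N.
Proof.
elim: k => // k; rewrite [isqrt k.+1]/=; case: ifP; nia.
Qed.

Lemma isqrt_eq m k : (m ^ 2 <= k < m.+1 ^ 2)%N -> isqrt k = m.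
Proof.
have := isqrt_bounds k => /andP[h1 h2] /andP[h3 h4].
have h5 : (isqrt k ^ 2 < m.+1 ^ 2)%N := leq_ltn_trans h1 h4.
have h6 : (m ^ 2 < (isqrt k).+1 ^ 2)%N := leq_ltn_trans h3 h2.
by rewrite !ltn_sqr in h5 h6; lia.
Qed.

Definition block_seq (k : nat) : bool := tau (isqrt k).

Lemma turns_cat t K L k : turns t (K + L) k = (turns t K k + turns t L (k + K))%N.
Proof.
elim: K k => [|K IHK] k /=; first by rewrite addn0.
by rewrite IHK addnA addSnnS.
Qed.

Lemma switches_cat t K L k :
  switches t (K + L) k = (switches t K k + switches t L (k + K))%N.
Proof.
elim: K k => [|K IHK] k /=; first by rewrite addn0.
by rewrite IHK addnA addSnnS.
Qed.

Lemma turns_const t L k v : (forall i, (i < L)%N -> t (k + i)%N = v) ->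
  turns t L k = (L * v)%N.
Proof.
elim: L k => //= L IHL k tv; rewrite -[k in t k]addn0 tv // IHL ?mulSn // => i iL.
by rewrite addSnnS tv.
Qed.

(** The count includes the passage from the last level of the block to the next one, hence 1 and not
    0. *)
Lemma switches_const t L k v : (forall i, (i < L)%N -> t (k + i)%N = v) ->
  (switches t L k <= 1)%N.
Proof.
elim: L k => //= L IHL k tv.
have tk : t k = v by rewrite -[k]addn0 tv.
case: L IHL tv => [|L] IHL tv; first by rewrite /= addn0 leq_b1.
have tk1 : t k.+1 = v by rewrite -addn1 tv.
rewrite tk tk1 eqxx add0n; apply: IHL => i iL.
by rewrite addSnnS tv.
Qed.

Lemma block_seqE m i : (i < m.*2.+1)%N -> block_seq (m ^ 2 + i) = tau m.
Proof. by move=> im; rewrite /block_seq (@isqrt_eq m) //; nia. Qed.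

Lemma sqr_succ m : (m.+1 ^ 2 = m ^ 2 + m.*2.+1)%N.
Proof. nia. Qed.

Lemma turns_block m :
  turns block_seq (m.+1 ^ 2) 0 = (turns block_seq (m ^ 2) 0 + m.*2.+1 * tau m)%N.
Proof.
rewrite sqr_succ turns_cat; congr addn; apply: turns_const => i im.
exact: block_seqE.
Qed.

Lemma switches_block m : (switches block_seq (m ^ 2) 0 <= m)%N.
Proof.
elim: m => // m IHm; rewrite sqr_succ switches_cat -[leqRHS]addn1 leq_add //.
by apply: (@switches_const _ _ _ (tau m)) => i im; exact: block_seqE.
Qed.

End Blocks.

(** * Greedy choice of the type of each block *)

Section Density.
Variables (R : realFieldType) (th1 th2 : R).
Hypotheses (th10 : 0 <= th1) (th12 : th1 <= th2) (th21 : th2 <= 1).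

(* The prescribed value is constant on [2 ^ 2 ^ i <= m < 2 ^ 2 ^ i.+1], an interval
   long enough for the initial error to become negligible. *)
Definition density (m : nat) : R :=
  if odd (trunc_log 2 (trunc_log 2 m)) then th1 else th2.

(** Number of rotating levels below [m ^ 2]: a block rotates exactly when the count is behind its
    target. *)
Fixpoint turn_count (m : nat) : nat :=
  if m is m'.+1 then
    (turn_count m' + m'.*2.+1 * ((turn_count m')%:R < density m' * m'%:R ^+ 2)%R)%N
  else 0%N.

Definition choice_seq (m : nat) : bool := (turn_count m)%:R < density m * m%:R ^+ 2.

Let th : [/\ 0 <= th1, th1 <= th2 & th2 <= 1]. Proof. by []. Qed.

Lemma density_bounds m : th1 <= density m <= th2.
Proof. by rewrite /density; case: ifP; rewrite lexx ?andbT. Qed.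

Lemma turn_countS m : (turn_count m.+1)%:R =
  (turn_count m)%:R + (if choice_seq m then 2 * m%:R + 1 else 0) :> R.
Proof.
rewrite /= natrD -/(choice_seq m); case: choice_seq; rewrite ?muln1 ?muln0 //.
by rewrite -addn1 natrD -mul2n natrM.
Qed.

Lemma turn_count_le_sqr m : (turn_count m)%:R <= m%:R ^+ 2 :> R.
Proof.
elim: m => [|m IHm]; first by rewrite expr0n.
have m0 : 0 <= m%:R :> R := ler0n _ _.
rewrite turn_countS -[m.+1%:R]natr1 sqrrD1 mulr2n; case: ifP => _; lra.
Qed.

(** A rotating block gains at least as much as [th1 * m ^+ 2] does. The other blocks start with a
    count not below this quantity, so they leave a deficit of at most one block. *)
Lemma turn_count_ge m : th1 * m%:R ^+ 2 - 2 * m%:R <= (turn_count m)%:R.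
Proof.
have [h0 h1 h2] := th.
elim: m => [|m IHm]; first by rewrite expr0n /= !mulr0 subrr.
have m0 : 0 <= m%:R :> R := ler0n _ _.
have /andP[x1 x2] := density_bounds m.
have th2m : th1 * m%:R <= m%:R by rewrite ler_piMl //; lra.
rewrite turn_countS -[m.+1%:R]natr1 sqrrD1 mulr2n !mulrDr.
rewrite /choice_seq; case: ltP => h; first lra.
have : th1 * m%:R ^+ 2 <= density m * m%:R ^+ 2 by rewrite ler_wpM2r // exprn_ge0.
lra.
Qed.

Lemma turn_count_le m : (turn_count m)%:R <= th2 * m%:R ^+ 2 + 2 * m%:R.
Proof.
have [h0 h1 h2] := th.
elim: m => [|m IHm]; first by rewrite expr0n /= !mulr0 addr0.
have m0 : 0 <= m%:R :> R := ler0n _ _.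
have /andP[x1 x2] := density_bounds m.
have th2m : 0 <= th2 * m%:R by rewrite mulr_ge0 //; lra.
rewrite turn_countS -[m.+1%:R]natr1 sqrrD1 mulr2n !mulrDr.
rewrite /choice_seq; case: ltP => h; last lra.
have : density m * m%:R ^+ 2 <= th2 * m%:R ^+ 2 by rewrite ler_wpM2r // exprn_ge0.
lra.
Qed.

(* The tracking error moves towards zero at each step, or is at most the step. *)
Lemma turn_count_track (x M : R) m0 m1 : 0 <= x <= 1 ->
  (forall j, (m0 <= j < m1)%N -> density j = x) ->
  m0%:R ^+ 2 <= M -> 2 * m1%:R <= M -> (m0 <= m1)%N ->
  `|(turn_count m1)%:R - x * m1%:R ^+ 2| <= M.
Proof.
move=> /andP[x0 x1] tx M0 M1.
have : forall m, (m0 <= m)%N -> (m <= m1)%N ->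
    `|(turn_count m)%:R - x * m%:R ^+ 2| <= M.
  elim=> [|m IHm].
    by move=> _ _; rewrite expr0n /= mulr0 subrr normr0 (le_trans _ M0) // sqr_ge0.
  have m_0 : 0 <= m%:R :> R := ler0n _ _.
  rewrite leq_eqVlt => /orP[/eqP<- _|m0m mm1].
    apply: le_trans M0; rewrite ler_norml.
    have := turn_count_le_sqr m0; have : 0 <= (turn_count m0)%:R :> R := ler0n _ _.
    have : x * m0%:R ^+ 2 <= m0%:R ^+ 2 by rewrite ler_piMl // sqr_ge0.
    have : 0 <= x * m0%:R ^+ 2 by rewrite mulr_ge0 // sqr_ge0.
    by move=> *; apply/andP; split; lra.
  have mM : 2 * m%:R + 2 <= M.
    apply: le_trans M1; have : m.+1%:R <= m1%:R :> R by rewrite ler_nat.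
    rewrite -natr1; lra.
  have := IHm m0m (ltnW mm1); rewrite turn_countS -[m.+1%:R]natr1 sqrrD1 mulr2n !mulrDr.
  have xm : x * m%:R <= m%:R by rewrite ler_piMl.
  have xm0 : 0 <= x * m%:R by rewrite mulr_ge0.
  have mj : (m0 <= m < m1)%N by apply/andP.
  rewrite /choice_seq (tx _ mj); case: ltP => h /ler_normlP[h1 h2];
    by rewrite ler_norml; apply/andP; split; lra.
by move=> H m01; apply: H.
Qed.

Lemma trunc_log2_tower i j : (2 ^ 2 ^ i <= j < 2 ^ 2 ^ i.+1)%N ->
  trunc_log 2 (trunc_log 2 j) = i.
Proof.
move=> /andP[h1 h2]; have j0 : (0 < j)%N by apply: leq_trans h1; rewrite expn_gt0.
have := trunc_log_bounds (isT : (1 < 2)%N) j0 => /andP[h3 h4].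
apply: trunc_log_eq => //; apply/andP; split.
  by rewrite -ltnS -(ltn_exp2l _ _ (isT : 1 < 2)%N) (leq_ltn_trans h1).
by rewrite -(ltn_exp2l _ _ (isT : 1 < 2)%N) (leq_ltn_trans h3).
Qed.

Lemma turn_count_tower i (m := (2 ^ 2 ^ i.+1)%N) :
  `|(turn_count m)%:R - (if odd i then th1 else th2) * m%:R ^+ 2| <= 2 * m%:R.
Proof.
have [h0 h1 h2] := th.
have m01 : (2 ^ 2 ^ i <= m)%N by rewrite leq_exp2l // leq_exp2l.
(* The starting point [2 ^ 2 ^ i] has square [m], so [2 * m] bounds both the initial error and the
   step. *)
apply: turn_count_track m01 => //.
- by case: ifP => _; apply/andP; split; lra.
- by move=> j /trunc_log2_tower ij; rewrite /density ij.
have : 0 <= m%:R :> R := ler0n _ _.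
by rewrite -natrX -expnM -expnSr -/m; lra.
Qed.

Lemma leq_tower N i : (N <= i)%N -> (N <= 2 ^ 2 ^ i.+1)%N.
Proof.
move=> Ni; apply: leq_trans Ni _.
apply: leq_trans (ltnW (ltn_expl i (isT : 1 < 2)%N)) _.
apply: leq_trans (ltnW (ltn_expl _ (isT : 1 < 2)%N)) _.
by rewrite leq_exp2l // leq_exp2l.
Qed.

Lemma turn_count_inf N :
  exists2 m, (N <= m)%N & (turn_count m)%:R <= th1 * m%:R ^+ 2 + 2 * m%:R.
Proof.
exists (2 ^ 2 ^ N.*2.+2)%N; first by apply: leq_tower; rewrite -addnn; lia.
by have := turn_count_tower N.*2.+1; rewrite /= odd_double /= => /ler_normlP[_]; lra.
Qed.

Lemma turn_count_sup N :
  exists2 m, (N <= m)%N & th2 * m%:R ^+ 2 - 2 * m%:R <= (turn_count m)%:R.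
Proof.
exists (2 ^ 2 ^ N.*2.+1)%N; first by apply: leq_tower; rewrite -addnn; lia.
by have := turn_count_tower N.*2; rewrite odd_double /= => /ler_normlP[+ _]; lra.
Qed.

Lemma turns_turn_count m : turns (block_seq choice_seq) (m ^ 2) 0 = turn_count m.
Proof. by elim: m => // m IHm; rewrite turns_block IHm. Qed.

End Density.

(** * Growth of the groups *)

Fixpoint letters (t : nat -> bool) (k : nat) : letter :=
  if k is k'.+1 then turn (t k') (letters t k') else L0.

(** * Growth bounds at depth [m ^ 2] *)

Section WreathGrowth.
Variables (R : realType) (eta : R).
Hypotheses (eta0 : 0 < eta) (eta1 : eta < 1).
Hypothesis etaE : eta ^+ 3 + eta ^+ 2 + eta = 2.
Variable t : nat -> bool.
Hypothesis switches_t : forall m, (switches t (m ^ 2) 0 <= m)%N.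

Let c := letters t.
Let cS k : c k.+1 = turn (t k) (c k). Proof. by []. Qed.

(** Allowing every [E] above [D] lets the upper and lower bounds share one constant later. *)
Lemma wreath_growth_le (S : {fset wreath c}) : exists2 D : R, 1 <= D &
  forall E, D <= E -> forall n m, (0 < n)%N ->
  ln (growth S n)%:R <= E ^+ m.+1 * (eta ^+ turns t (m ^ 2) 0 * n%:R + 2 ^+ (m ^ 2)%N).
Proof.
have e0 := eta0; have e1 := eta1.
have [C1 hC1] := word_ball_le S (@wreath_generates c).
pose C : R := (1 - eta)^-1.
have Cge1 : 1 <= C by rewrite /C -invr1 lef_pV2 ?posrE; lra.
pose D : R := C * (1 + ln 9 * (6 * C1%:R + 7)).
have l9 : 0 <= ln 9 :> R by rewrite ln_ge0 // ler1n.
have C10 : 0 <= C1%:R :> R by [].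
have l9C : 0 <= ln 9 * (6 * C1%:R + 7) :> R by rewrite mulr_ge0 //; lra.
have CD : C <= D by rewrite ler_peMr //; lra.
exists D => [|E DE n m n0]; first lra.
set T := turns t (m ^ 2) 0; set P : R := 2 ^+ (m ^ 2).
have P1 : 1 <= P by rewrite exprn_ege1 // ler1n.
have n1 : 1 <= n%:R :> R by rewrite ler1n.
have eT : 0 < eta ^+ T <= 1 by rewrite exprn_gt0 // exprn_ile1 // ltW.
have CS1 : 1 <= C ^+ m by rewrite exprn_ege1.
pose X := eta ^+ T * n%:R + P.
have X1 : 1 <= X.
  by rewrite /X; have : 0 <= eta ^+ T * n%:R; [rewrite mulr_ge0 //; lra | lra].
(* A ball element has a word of at most [3 * C1 * n] letters, of cost at most [6 * C1 * n + 1]. The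
   main term of [size_code] needs [6 * C1 + 3], its additive term 4. *)
pose M : R := C * C ^+ m * (6 * C1%:R + 7) * X.
have M0 : 0 <= M by rewrite !mulr_ge0 //; lra.
have sizeM s : (size s <= 3 * (C1 * n))%N ->
    (size (code c (m ^ 2) 0 (one_spinal, s)) <= Num.truncn M)%N.
  move=> ss; rewrite truncn_ge_nat //.
  apply: le_trans (size_code eta0 eta1 etaE cS _ _ _) _; rewrite -/C -/T -/P.
  have hs : cost eta (t 0) (c 0) (one_spinal, s) <= 6 * (C1%:R * n%:R) + 1.
    apply: le_trans (cost_le_size eta0 eta1 etaE _ _ _) _.
    have : (size s)%:R <= 3 * (C1%:R * n%:R) :> R by rewrite -!natrM ler_nat.
    by move=> /=; lra.
  have hS : C ^+ switches t (m ^ 2) 0 <= C ^+ m by rewrite ler_weXn2l.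
  have i1 : eta ^+ T * cost eta (t 0) (c 0) (one_spinal, s) + 2 * P - 1 <=
      (6 * C1%:R + 3) * X.
    have : eta ^+ T * cost eta (t 0) (c 0) (one_spinal, s) <=
        eta ^+ T * (6 * (C1%:R * n%:R) + 1).
      by rewrite ler_wpM2l //; lra.
    have : 0 <= C1%:R * P by rewrite mulr_ge0 //; lra.
    have : 0 <= eta ^+ T * n%:R by rewrite mulr_ge0 //; lra.
    rewrite /X; lra.
  have i2 : C ^+ switches t (m ^ 2) 0 *
      (eta ^+ T * cost eta (t 0) (c 0) (one_spinal, s) + 2 * P - 1) <=
      C ^+ m * ((6 * C1%:R + 3) * X).
    apply: ler_pM => //; first by rewrite exprn_ge0 //; lra.
    have : 0 <= eta ^+ T * cost eta (t 0) (c 0) (one_spinal, s); last lra.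
    rewrite mulr_ge0 //; first lra.
    apply: le_trans (cost_ge_size eta0 eta1 etaE _ _ _); rewrite mulr_ge0 //.
    by rewrite subr_ge0 ltW.
  have i3 : 4 * P - 1 <= C * C ^+ m * (4 * X).
    apply: le_trans (_ : 1 * (4 * X) <= _).
      have : 0 <= eta ^+ T * n%:R by rewrite mulr_ge0 //; lra.
      rewrite /X; lra.
    by rewrite ler_wpM2r ?mulr_ege1 //; lra.
  have := ler_wpM2l (le_trans ler01 Cge1) i2; rewrite /M; lra.
have gn := growth_wreath_leq (S := S) (r := n) _ sizeM.
have {}gn : (growth S n <= 9 ^ Num.truncn M)%N.
  by apply: gn => g /hC1 /ball_word_elt.
apply: le_trans (_ : ln 9 * M <= _).
  apply: le_trans (_ : ln ((9 ^ Num.truncn M)%N%:R) <= _).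
    by apply: ln_le_ge1; rewrite ?ler1n ?expn_gt0 // ler_nat.
  rewrite natrX lnXn // -[ln 9 *+ _]mulr_natr ler_wpM2l //.
  by have /andP[] := truncn_itv M0.
have h1 : ln 9 * M <= D * C ^+ m * X.
  have -> : ln 9 * M = C * C ^+ m * X * (ln 9 * (6 * C1%:R + 7)) by rewrite /M; ring.
  have -> : D * C ^+ m * X = C * C ^+ m * X * (1 + ln 9 * (6 * C1%:R + 7)).
    by rewrite /D; ring.
  by rewrite ler_wpM2l ?mulr_ge0 //; lra.
apply: le_trans h1 _; rewrite exprS ler_wpM2r //; first lra.
apply: ler_pM => //; try lra.
by rewrite lerXn2r ?nnegrE //; lra.
Qed.

Lemma wreath_growth_ge (S : {fset wreath c}) : generates S -> exists2 D : R, 1 <= D &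
  forall E, D <= E -> forall n m,
  E ^+ m.+1 * (2 ^+ (m ^ 2)%N / eta ^+ turns t (m ^ 2) 0) <= n%:R ->
  (2 ^ (2 ^ (m ^ 2)) <= growth S n)%N.
Proof.
move=> genS; have e0 := eta0; have e1 := eta1.
have [C1 hC1] := word_ball_le (wreath_gens c) genS.
pose C : R := 2 / eta ^+ 2.
have Cge1 : 1 <= C.
  rewrite ler_pdivlMr ?exprn_gt0 // mul1r.
  apply: le_trans (_ : 1 <= _); last by rewrite ler1n.
  by rewrite exprn_ile1 // ltW.
have C10 : 0 <= C1%:R :> R by [].
(* One factor [C] comes from the seed weight 2 over the least weight [eta ^+ 2], and [1 + C1] covers
   the change of generators. *)
exists (C * (1 + C1%:R)) => [|E DE n m En]; first by rewrite mulr_ege1 //; lra.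
have [l [szl ul sl linj]] := size_word_family eta0 eta1 etaE
  (word_family_depth eta0 eta1 etaE cS (m ^ 2) 0).
rewrite -szl; apply: growth_wreath_geq => // s /sl {}sl.
have : word_ball S (C1 * size s) (word_elt c s) by apply: hC1; exact: word_elt_ball.
apply: word_ballS; rewrite -(ler_nat R); apply: le_trans En.
set T := turns t (m ^ 2) 0 in sl *; set P : R := 2 ^+ (m ^ 2) / eta ^+ T in sl *.
have P0 : 0 <= P by rewrite divr_ge0 ?exprn_ge0 // ltW.
clearbody P.
have CS : C ^+ switches t (m ^ 2) 0 <= C ^+ m by rewrite ler_weXn2l.
have CE : C ^+ m <= E ^+ m.
  have : C <= C * (1 + C1%:R) by rewrite ler_peMr //; lra.
  by move=> ?; rewrite lerXn2r ?nnegrE //; lra.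
have {}sl : (size s)%:R <= C * E ^+ m * P.
  apply: le_trans sl _; rewrite -[_ * 2 / _]mulrA -/C mulrC mulrA.
  by rewrite ler_wpM2r // ler_wpM2l ?(le_trans CS) //; lra.
rewrite natrM; apply: le_trans (ler_wpM2l C10 sl) _.
clearbody C; have CC1 : 0 <= C1%:R * C by rewrite mulr_ge0 //; lra.
by rewrite exprS !mulrA ler_wpM2r // ler_wpM2r ?exprn_ge0 //; lra.
Qed.

End WreathGrowth.

(** * Densities realizing given exponents *)

Section Exponent.
Variables (R : realType) (eta : R).
Hypotheses (eta0 : 0 < eta) (eta1 : eta < 1).
Hypothesis etaE : eta ^+ 3 + eta ^+ 2 + eta = 2.

(** [th] is found by solving the last equation; it decreases in [alpha], from 1 at the least
    admissible exponent to 0 at exponent 1. *)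
Lemma exponent_density (alpha : R) :
  ln 2 / (ln 2 - ln eta) <= alpha -> alpha <= 1 ->
  let th := ln 2 * (alpha^-1 - 1) / - ln eta in
  [/\ 0 < alpha, 0 <= th, th <= 1 & ln 2 / (ln 2 + th * - ln eta) = alpha].
Proof.
have a0 : 0 < ln 2 :> R by rewrite ln_gt0 ?ltr1n.
have h0 : 0 < - ln eta by rewrite oppr_gt0 ln_lt0 // eta0.
move: (ln 2) (- ln eta) a0 h0 => a h a0 h0 ha al1 th.
have ah : 0 < a + h by lra.
have al0 : 0 < alpha by apply: lt_le_trans ha; rewrite divr_gt0.
split=> //.
- by rewrite divr_ge0 ?mulr_ge0 ?subr_ge0 ?invf_ge1 // ltW.
- rewrite ler_pdivrMr // mul1r mulrBr mulr1 lerBlDr.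
  by rewrite ler_pdivrMr // mulrC -ler_pdivrMr // addrC.
- rewrite divfK ?gt_eqF // mulrBr mulr1 addrC subrK.
  by rewrite -[X in X / _]mulr1 -mulf_div divff ?gt_eqF // mul1r div1r invrK.
Qed.

Lemma group_of_exponents (alpha beta : R) :
  ln 2 / (ln 2 - ln eta) <= alpha -> alpha <= beta -> beta <= 1 ->
  exists G : groupType, finitely_generated G /\
    forall S : {fset G}, generates S ->
    let u n := growth_exponent R S n in
    [/\ forall e, 0 < e -> exists N, forall n, (N <= n)%N -> u n <= beta + e,
        forall e N, 0 < e -> exists2 n, (N <= n)%N & beta - e <= u n,
        forall e, 0 < e -> exists N, forall n, (N <= n)%N -> alpha - e <= u n
      & forall e N, 0 < e -> exists2 n, (N <= n)%N & u n <= alpha + e].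
Proof.
move=> ha ab b1.
have [al0 _ th21 limA] := exponent_density ha (le_trans ab b1).
have [be0 th10 _ limB] := exponent_density (le_trans ha ab) b1.
set th2 := _ / _ in th21 limA; set th1 := _ / _ in th10 limB.
(* The exponent decreases with the density, so [beta] gives the smaller density [th1]. *)
have th12 : th1 <= th2.
  have a0 : 0 < ln 2 :> R by rewrite ln_gt0 ?ltr1n.
  have h0 : 0 < - ln eta by rewrite oppr_gt0 ln_lt0 // eta0.
  rewrite ler_wpM2r ?invr_ge0 ?(ltW h0) // ler_wpM2l ?(ltW a0) //.
  by rewrite lerB // lef_pV2.
pose t := block_seq (choice_seq th1 th2).
exists (wreath (letters t)); split; first exact: wreath_fg.
move=> S genS u.
have sw m : (switches t (m ^ 2) 0 <= m)%N by exact: switches_block.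
have [D1 D11 hD1] := wreath_growth_le eta0 eta1 etaE sw S.
have [D2 D21 hD2] := wreath_growth_ge eta0 eta1 etaE sw genS.
pose D := D1 + D2.
have D_ge1 : 1 <= D by rewrite /D; lra.
have {}hD1 : forall n m, (0 < n)%N -> ln (growth S n)%:R <=
    D ^+ m.+1 * (eta ^+ turn_count th1 th2 m * n%:R + 2 ^+ (m ^ 2)%N).
  by move=> n m; rewrite -turns_turn_count; apply: hD1; rewrite /D; lra.
have {}hD2 : forall n m,
    D ^+ m.+1 * (2 ^+ (m ^ 2)%N / eta ^+ turn_count th1 th2 m) <= n%:R ->
    (2 ^ (2 ^ (m ^ 2)) <= growth S n)%N.
  by move=> n m; rewrite -turns_turn_count; apply: hD2; rewrite /D; lra.
have T1 := turn_count_ge th10 th12 th21; have T2 := turn_count_le th10 th12 th21.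
have T3 := turn_count_inf th10 th12 th21; have T4 := turn_count_sup th10 th12 th21.
rewrite -limA -limB; split=> e.
- exact: (expo_le eta0 eta1 th10 th12 D_ge1 hD1 T1).
- exact: (expo_freq_ge eta0 eta1 th10 th12 D_ge1 hD2 T3).
- exact: (expo_ge eta0 eta1 th10 th12 D_ge1 hD2 T2).
- exact: (expo_freq_le eta0 eta1 th10 th12 D_ge1 hD1 T4).
Qed.

End Exponent.

Theorem theorem1p1 (R : realType) (eta : R)
    (eta_root : root ('X^3 + 'X^2 + 'X - 2%:P) eta) :
  let alpha0 : R := ln 2 / (ln 2 - ln eta) in
  (forall alpha beta : R,
     alpha0 <= alpha -> alpha <= beta -> beta <= 1 ->
     exists G : groupType, finitely_generated G /\
       forall S : {fset G}, generates S ->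
         limn_einf (fun r => (growth_exponent R S r)%:E) = alpha%:E /\
         limn_esup (fun r => (growth_exponent R S r)%:E) = beta%:E) /\
  (forall alpha : R,
     alpha0 <= alpha -> alpha <= 1 ->
     exists G : groupType, finitely_generated G /\
       forall S : {fset G}, generates S ->
         growth_exponent R S r @[r --> \oo] --> alpha).
Proof.
have etaE : eta ^+ 3 + eta ^+ 2 + eta = 2.
  by move: eta_root; rewrite rootE !hornerE => /eqP; lra.
have eta0 : 0 < eta.
  rewrite ltNge; apply/negP => eta_le0.
  (* By [etaE] this product is 2, while its second factor is positive. *)
  have : eta * (eta ^+ 2 + eta + 1) <= 0 by rewrite mulr_le0_ge0 //; nra.
  by have := etaE; lra.
have eta1 : eta < 1.
  rewrite ltNge; apply/negP => eta_ge1.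
  have := exprn_ege1 2 eta_ge1; have := exprn_ege1 3 eta_ge1; lra.
move=> alpha0; split=> [alpha beta ha ab b1|alpha ha a1].
  have [G [fgG hG]] := group_of_exponents eta0 eta1 etaE ha ab b1.
  exists G; split=> // S /hG[h1 h2 h3 h4].
  by split; [exact: limn_einf_eq | exact: limn_esup_eq].
(* The limit is the case [beta = alpha], in which the two bounds valid for all large [r] meet. *)
have [G [fgG hG]] := group_of_exponents eta0 eta1 etaE ha (lexx _) a1.
by exists G; split=> // S /hG[h1 _ h3 _]; exact: cvgn_eq.
Qed.
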